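(* Let $\pi$ be an irreducible cuspidal representation of $\mathrm{GL}_3(\mathbb F)$ associated with the regular multiplicative character $\theta:\mathbb F_3^*\to\mathbb C^*$, where $\mathbb F_3$ denotes the field extension of $\mathbb F$ of degree $3$. Then $$\gamma(\pi,\wedge^2,\psi)=q^{-\frac32}\sum_{\xi\in\mathbb F_3^*}\psi\left(-\frac{\mathrm{Tr}_{\mathbb F_3/\mathbb F}(\xi^2)}{\mathrm N_{\mathbb F_3/\mathbb F}(\xi)}\right)\theta(\xi^2).$$
   Context: $\mathbb F$ is a finite field with $q$ elements, $\psi:\mathbb F\to\mathbb C^*$ is a non-trivial additive character, and $\mathbb F_k$ denotes the degree $k$ extension of $\mathbb F$ inside a fixed algebraic closure. Correspondence with regular characters: a character $\theta$ of $\mathbb F_n^*$ is regular if $\theta^{q^k}\ne\theta$ for $1\le k\le n-1$. Irreducible cuspidal representations of $\mathrm{GL}_n(\mathbb F)$ are in bijection with Galois orbits of regular characters of $\mathbb F_n^*$ (Green, Gelfand): $\pi$ is associated with $\theta$ when its character satisfies $\mathrm{tr}\,\pi(g)=0$ unless the characteristic polynomial of $g$ is a power of an irreducible polynomial of some degree $d\mid n$, and in that case $\mathrm{tr}\,\pi(g)=(-1)^{n-1}\left(\sum_{i=0}^{d-1}\theta(\alpha^{q^i})\right)\prod_{j=1}^{k-1}(1-q^{dj})$, where $\alpha\in\mathbb F_d$ is an eigenvalue of $g$ and $k=\dim_{\mathbb F_d}\ker(g-\alpha)$. Gamma factor for $\mathrm{GL}_3$ (the case $m=1$ of the general definition for $\mathrm{GL}_{2m+1}$):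 $N_3\le\mathrm{GL}_3(\mathbb F)$ is the upper triangular unipotent subgroup with $\psi(u)=\psi(u_{12}+u_{23})$. $\mathcal W(\pi,\psi)$ is the Whittaker model: the functions $g\mapsto\ell(\pi(g)v)$, $v\in V_\pi$, where $0\ne\ell\in\mathrm{Hom}_{N_3}(\pi,\psi)$; the group acts by right translation. $\tilde W(g)=W(w_3\,{}^tg^{-1})\in\mathcal W(\tilde\pi,\psi^{-1})$, with $w_3$ the matrix with ones on the antidiagonal and $\tilde\pi$ the contragredient. $\mathcal S(\mathbb F)$ is the space of functions $\mathbb F\to\mathbb C$ and $\mathcal F_\psi\phi(y)=q^{-1/2}\sum_x\phi(x)\psi(xy)$. Define $$J_{\pi,\psi}(W,\phi)=\frac1{|\mathbb F^*|\,|\mathbb F|}\sum_{g\in\mathbb F^*}\sum_{z\in\mathbb F}W\left(\begin{pmatrix}g&&\\&g&\\&&1\end{pmatrix}\begin{pmatrix}1&&\\&1&\\&z&1\end{pmatrix}\right)\phi(z),$$ and $\tilde J_{\pi,\psi}(W,\phi)=J_{\tilde\pi,\psi^{-1}}\left(\tilde\pi\begin{pmatrix}&1&\\1&&\\&&1\end{pmatrix}\tilde W,\mathcal F_\psi\phi\right)$. Then $\gamma(\pi,\wedge^2,\psi)\in\mathbb C^*$ is the unique non-zero constant (it exists) such that $\tilde J_{\pi,\psi}(W,\phi)=\gamma(\pi,\wedge^2,\psi)J_{\pi,\psi}(W,\phi)$ for all $W\in\mathcal W(\pi,\psi)$, $\phi\in\mathcal S(\mathbb F)$.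
   Formalization: For odd q no constant satisfies the functional equation with the Fourier transform taken with respect to ψ; the formal theorem takes it with respect to ψ⁻¹ (existence, uniqueness, value), and also shows that any constant for the stated definition equals the formula. *)

(* Defs.v *)
From HB Require Import structures.
From mathcomp Require Import all_boot all_order all_fingroup all_algebra.
From mathcomp Require Import all_solvable all_field all_character.

Set Implicit Arguments.
Unset Strict Implicit.
Unset Printing Implicit Defensive.

Import Order.TTheory GRing.Theory Num.Theory.
Local Open Scope ring_scope.

(* Characters with values in the multiplicative group of C.  A multiplicative
   character of E^* is a function on E whose value at 0 is irrelevant. *)
Definition additive_character (F : fieldType) (C : fieldType) (psi : F -> C) :=
  psi 0 = 1 /\ forall x y, psi (x + y) = psi x * psi y.

Definition multiplicative_character (E : fieldType) (C : fieldType)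
    (theta : E -> C) :=
  theta 1 = 1 /\
  forall x y, x != 0 -> y != 0 -> theta (x * y) = theta x * theta y.

Definition regular_character (F : finFieldType) (E : fieldExtType F)
    (C : fieldType) (theta : E -> C) :=
  forall k : nat, (0 < k < \dim {:E})%N ->
    exists2 x : E, x != 0 & theta x ^+ (#|F| ^ k) != theta x.

(* Trace and norm of E / F, as the trace and determinant of the F-linear map
   y |-> x * y. *)
Definition field_trace (F : fieldType) (E : fieldExtType F) (x : E) : F :=
  \tr (passmx.mxof (vbasis {:E}) (vbasis {:E}) (amull x)).

Definition field_norm (F : fieldType) (E : fieldExtType F) (x : E) : F :=
  \det (passmx.mxof (vbasis {:E}) (vbasis {:E}) (amull x)).

(* A block structure on the indices is given by a nondecreasing map b (indices
   with the same value are in the same block).  [unip_radical b u] says that u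
   is in the unipotent radical of the standard (block upper triangular)
   parabolic subgroup of GL_N attached to b; for b = the identity this is the
   group of upper triangular unipotent matrices. *)
Definition unip_radical (F : finFieldType) (N : nat)
    (b : 'I_N.-1.+1 -> nat) (u : {'GL_N[F]}) :=
  forall i j, (b j <= b i)%N -> GLval u i j = (i == j)%:R.

(* A representation rG acts on the left on column vectors.  It is cuspidal when
   the unipotent radical of a proper parabolic subgroup has no nonzero fixed
   vector. *)
Definition cuspidal (F : finFieldType) (N : nat) (C : fieldType) (n : nat)
    (rG : mx_representation C [set: {'GL_N[F]}] n) :=
  forall b : 'I_N.-1.+1 -> nat,
    (forall i j : 'I_N.-1.+1, (i <= j)%N -> (b i <= b j)%N) ->
    (exists i j, (b i < b j)%N) ->
  forall v : 'cV[C]_n,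
    (forall u, unip_radical b u -> rG u *m v = v) -> v = 0.

(* Eigenvalues and the kernel of g - alpha are taken over E, which contains the
   residue field F_d of the irreducible factor p of degree d. *)
Definition associated_with (F : finFieldType) (E : fieldExtType F) (N : nat)
    (C : fieldType) (theta : E -> C) (n : nat)
    (rG : mx_representation C [set: {'GL_N[F]}] n) :=
  (forall g : {'GL_N[F]},
     (forall (p : {poly F}) (m : nat),
        irreducible_poly p -> char_poly (GLval g) <> p ^+ m) ->
     \tr (rG g) = 0)
  /\
  (forall (g : {'GL_N[F]}) (p : {poly F}) (m d : nat) (alpha : E),
     irreducible_poly p -> size p = d.+1 -> char_poly (GLval g) = p ^+ m ->
     let gE := map_mx (in_alg E) (GLval g) in
     eigenvalue gE alpha ->
     let k := \rank (eigenspace gE alpha) in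
     \tr (rG g) = (-1) ^+ (N - 1)
                  * (\sum_(0 <= i < d) theta (alpha ^+ (#|F| ^ i)))
                  * \prod_(1 <= j < k) (1 - (#|F| ^ (d * j))%:R)).

(* The matrix with the given rows, and its class in GL_3 (1 if the matrix is
   singular, which does not happen below: see [GLval_of_mx] and the
   unitmx lemmas). *)
Definition mx_of_rows (F : finFieldType) (s : seq (seq F)) : 'M[F]_3 :=
  \matrix_(i < 3, j < 3) (nth [::] s i)`_j.

Definition GL_of_mx (F : finFieldType) (A : 'M[F]_3) : {'GL_3[F]} :=
  insubd (1%g : {'GL_3[F]}) A.

Lemma GLval_of_mx (F : finFieldType) (A : 'M[F]_3) :
  A \in unitmx -> GLval (GL_of_mx A) = A.
Proof. by move=> uA; apply: (@insubdK _ _ {'GL_3[F]}). Qed.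

Definition diag_ggo (F : finFieldType) (g : F) : 'M[F]_3 :=
  mx_of_rows [:: [:: g; 0; 0];
                 [:: 0; g; 0];
                 [:: 0; 0; 1]].

Definition lower_z (F : finFieldType) (z : F) : 'M[F]_3 :=
  mx_of_rows [:: [:: 1; 0; 0];
                 [:: 0; 1; 0];
                 [:: 0; z; 1]].

Definition swap12 (F : finFieldType) : 'M[F]_3 :=
  mx_of_rows [:: [:: 0; 1; 0];
                 [:: 1; 0; 0];
                 [:: 0; 0; 1]].

Definition antidiag3 (F : finFieldType) : 'M[F]_3 :=
  mx_of_rows [:: [:: 0; 0; 1];
                 [:: 0; 1; 0];
                 [:: 1; 0; 0]].

Lemma unitmx_rows (F : finFieldType) (A B : 'M[F]_3) :
  (forall i j, \sum_(k < 3) A i k * B k j = (i == j)%:R) -> A \in unitmx.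
Proof.
move=> AB; suff /mulmx1_unit[]: A *m B = 1%:M by [].
by apply/matrixP => i j; rewrite !mxE AB.
Qed.

Lemma diag_ggo_unitmx (F : finFieldType) (g : F) :
  g != 0 -> diag_ggo g \in unitmx.
Proof.
move=> g0; apply: (@unitmx_rows _ _ (diag_ggo g^-1)) => i j.
rewrite !big_ord_recl big_ord0 !mxE.
by case: i => [[|[|[|//]]] ?]; case: j => [[|[|[|//]]] ?];
   rewrite /= ?mulr0 ?mul0r ?mulr1 ?addr0 ?add0r ?divff.
Qed.

Lemma lower_z_unitmx (F : finFieldType) (z : F) : lower_z z \in unitmx.
Proof.
apply: (@unitmx_rows _ _ (lower_z (- z))) => i j.
rewrite !big_ord_recl big_ord0 !mxE.
by case: i => [[|[|[|//]]] ?]; case: j => [[|[|[|//]]] ?];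
   rewrite /= ?mulr0 ?mul0r ?mul1r ?mulr1 ?addr0 ?add0r ?subrr.
Qed.

Lemma swap12_unitmx (F : finFieldType) : swap12 F \in unitmx.
Proof.
apply: (@unitmx_rows _ _ (swap12 F)) => i j.
rewrite !big_ord_recl big_ord0 !mxE.
by case: i => [[|[|[|//]]] ?]; case: j => [[|[|[|//]]] ?];
   rewrite /= ?mulr0 ?mul0r ?mulr1 ?addr0 ?add0r.
Qed.

Lemma antidiag3_unitmx (F : finFieldType) : antidiag3 F \in unitmx.
Proof.
apply: (@unitmx_rows _ _ (antidiag3 F)) => i j.
rewrite !big_ord_recl big_ord0 !mxE.
by case: i => [[|[|[|//]]] ?]; case: j => [[|[|[|//]]] ?];
   rewrite /= ?mulr0 ?mul0r ?mulr1 ?addr0 ?add0r.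
Qed.

(* l in Hom_{N_3}(pi, psi), as a row vector: l (v) = l *m v.  The entries of u
   are numbered from 0. *)
Definition whittaker_functional (F : finFieldType) (C : fieldType) (n : nat)
    (rG : mx_representation C [set: {'GL_3[F]}] n) (psi : F -> C)
    (l : 'rV[C]_n) :=
  forall u : {'GL_3[F]}, unip_radical (fun i => i : nat) u ->
    l *m rG u = psi (GLval u (inord 0) (inord 1) + GLval u (inord 1) (inord 2))
                *: l.

Definition whittaker_model (F : finFieldType) (C : fieldType) (n : nat)
    (rG : mx_representation C [set: {'GL_3[F]}] n) (psi : F -> C)
    (W : {'GL_3[F]} -> C) :=
  exists2 l : 'rV[C]_n, l != 0 /\ whittaker_functional rG psi l &
  exists v : 'cV[C]_n, forall g, W g = (l *m rG g *m v) 0 0.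

Definition whittaker_dual (F : finFieldType) (C : fieldType)
    (W : {'GL_3[F]} -> C) (g : {'GL_3[F]}) : C :=
  W (GL_of_mx (antidiag3 F) * GL_of_mx (GLval g^-1)^T)%g.

Definition fourier (F : finFieldType) (C : numClosedFieldType) (psi : F -> C)
    (phi : F -> C) (y : F) : C :=
  (sqrtC #|F|%:R)^-1 * \sum_(x : F) phi x * psi (x * y).

Definition JS_sum (F : finFieldType) (C : fieldType)
    (W : {'GL_3[F]} -> C) (phi : F -> C) : C :=
  (#|[pred x : F | x != 0]| * #|F|)%:R^-1 *
  \sum_(g : F | g != 0) \sum_(z : F)
    W (GL_of_mx (diag_ggo g) * GL_of_mx (lower_z z))%g * phi z.

(* psiF is the additive character used in the Fourier transform. *)
Definition JS_dual_sum (F : finFieldType) (C : numClosedFieldType)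
    (psiF : F -> C) (W : {'GL_3[F]} -> C) (phi : F -> C) : C :=
  JS_sum (fun g => whittaker_dual W (g * GL_of_mx (swap12 F))%g)
         (fourier psiF phi).

(* The constant of proportionality in the functional equation.  Replacing W by
   its right translate under lower_z a replaces, in JS_sum, phi by its translate
   phi (_ - a) and multiplies, in JS_dual_sum, the transform of phi at z by
   psi (- (a * z)); so a common constant for all W and phi can exist only when
   the Fourier transform is taken with respect to psiF = psi^-1.  With psiF = psi
   there is none in odd characteristic; in characteristic 2, psi^-1 = psi. *)
Definition is_exterior_square_gamma (F : finFieldType)
    (C : numClosedFieldType) (n : nat)
    (rG : mx_representation C [set: {'GL_3[F]}] n) (psi psiF : F -> C)
    (c : C) :=
  c != 0 /\
  forall (W : {'GL_3[F]} -> C) (phi : F -> C), whittaker_model rG psi W ->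
    JS_dual_sum psiF W phi = c * JS_sum W phi.

(* Main.v *)
Require Import Defs.
From HB Require Import structures.
From mathcomp Require Import all_boot all_order all_fingroup all_algebra.
From mathcomp Require Import all_solvable all_field all_character.
From mathcomp Require Import complex reals ring.

(** The functional equation compares two functionals on pi that transform in
    the same way under a subgroup H whose relevant character occurs in pi with
    multiplicity one; they are therefore proportional, and the constant is
    computed from values of the Bessel function of pi.

    Let l be a Whittaker functional and W(g) = l (pi(g) v).  For phi the delta
    function at 0, J(W, phi) is, up to the common normalization, the value at v
    of the period sum_g l pi(diag(g, g, 1)), and the dual sum is q^(-1/2) times
    the value at v of the period sum_(g, z) l pi(cyc g 0 z 0), where
    [cyc g x y w] is a monomial matrix of the 3-cycle times a unipotent matrix.
    Both periods are multiplied by psi a under the elements [mira a b g] of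
    H = {diag(g, g, 1) times unipotent matrices with entry (2,3) zero}.  By the
    character formula this character of H has multiplicity one in pi
    ([mirabolic_rank1]): an element with g != 1 has two distinct eigenvalues in
    F, hence trace 0, and the unipotent elements that remain have known traces.
    Translating W by [lower_z x] turns the delta function at 0 into the one at
    x, and multiplies the summand of the dual period by psi (x z)
    ([cyc_lower_equiv]); so proportionality of the periods is the functional
    equation for every phi ([JS_sumE], [JS_dual_sumE]).

    The same count of traces for the unipotent group N and its character psi
    shows that the psi-projector (1/|N|) sum_u psi(u)^-1 pi(u) has the form v l
    with l v = 1 ([whittaker_rank1]).  The Bessel function B(M) = l pi(M) v is
    thus the average over u in N of psi(u)^-1 tr pi(M u).  It vanishes at M as
    soon as M intertwines two elements of N with different values of psi; so
    the diagonal period takes the value B(1) = 1 at v, and the other period the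
    value q sum_g B(cyc g 0 0 0).

    The matrix [cyc g x y w] has a cyclic vector, so the trace of pi at it is
    the sum of theta xi over all xi in E whose multiplication map has the same
    characteristic polynomial ([tr_cyc]).  That polynomial is
    t^3 - g (x + w) t^2 + g^2 (x w - y) t - g^2: given xi, g with N xi = g^2,
    the entry x is free and determines w and y.  There remains the sum of
    psi (- Tr xi / g) theta xi over the pairs (xi, g) with N xi = g^2, and
    eta |-> (eta^2, N eta) is a bijection from E^* onto these pairs, with
    inverse (xi, g) |-> g xi^(-q(q+1)/2), because q(q+1) = q + q^2 and
    N xi = xi^(1 + q + q^2).  This is the sum over eta in the theorem.

    The constant is nonzero because the translate of the second period by a
    permutation matrix takes the value B(1) at v ([cyc_period_neq0]).  It is
    unique, for the Fourier transform with respect to psi or its inverse,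
    because both transforms agree on the delta function at 0. *)

Set Implicit Arguments.
Unset Strict Implicit.
Unset Printing Implicit Defensive.

Import Order.TTheory GRing.Theory Num.Theory.
Import passmx.
Local Open Scope ring_scope.
Local Open Scope complex_scope.

(** * Multiplicity one from a trace *)

(** In a full rank factorization e = c r, cancelling c and r in e e = e leaves
    r c = 1; so the trace of [e] is its rank. *)
Lemma idempotent_trace1 (C : numFieldType) n (e : 'M[C]_n) :
  e *m e = e -> \tr e = 1 ->
  exists (v : 'cV[C]_n) (l : 'rV[C]_n), e = v *m l /\ l *m v = 1%:M.
Proof.
move=> ee tre.
suff [r [v [l [re def_e lv]]]] : exists r (v : 'M[C]_(n, r)) (l : 'M[C]_(r, n)),
    [/\ r%:R = 1 :> C, e = v *m l & l *m v = 1%:M].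
  have {re} r1 : r = 1%N by apply/eqP; rewrite -(@eqr_nat C) re.
  by move: v l def_e lv; rewrite r1 => v l *; exists v, l.
exists (\rank e), (col_base e), (row_base e).
have lv : row_base e *m col_base e = 1%:M.
  apply: (row_free_inj (row_base_free e)) => /=.
  apply: (row_full_inj (col_base_full e)).
  by rewrite mul1mx mulmx_base -mulmxA mulmxA !mulmx_base ee.
rewrite mulmx_base; split=> //.
by rewrite -[RHS]tre -[e in RHS](mulmx_base e) mxtrace_mulC lv mxtrace1.
Qed.

(** A finite group is presented here through a parametrization [rho] of its
    image by the indices in [P], with multiplication [m] on the indices, since
    the groups below come with coordinates.  The projector on the
    [lam]-isotypic part has trace 1, so it factors as a column [v] times a row
    [l]; a functional on which the group acts by [lam] is fixed by the
    projector, hence is a multiple of [l]. *)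
Lemma isotypic_rank1 (C : numFieldType) n (I : finType) (P : pred I)
    (m : I -> I -> I) (lam : I -> C) (rho : I -> 'M[C]_n) :
  (forall i, P i -> lam i != 0) ->
  (forall i j, P i -> P j -> lam (m i j) = lam i * lam j) ->
  (forall i j, P i -> P j -> rho i *m rho j = rho (m i j)) ->
  (forall i, P i -> injective (m i)) ->
  (forall j, P j -> injective (m^~ j)) ->
  (forall i j, P i -> P (m i j) = P j) ->
  (forall i j, P j -> P (m i j) = P i) ->
  (0 < #|P|)%N ->
  \sum_(i | P i) (lam i)^-1 * \tr (rho i) = #|P|%:R ->
  exists (v : 'cV[C]_n) (l : 'rV[C]_n),
    [/\ #|P|%:R *: (v *m l) = \sum_(i | P i) (lam i)^-1 *: rho i,
        l *m v = 1%:M,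
        forall i, P i -> l *m rho i = lam i *: l,
        forall i, P i -> rho i *m v = lam i *: v &
        forall x, (forall i, P i -> x *m rho i = lam i *: x) ->
                  x = (x *m v) 0 0 *: l].
Proof.
move=> lam0 lamM rhoM mI mI' PM PM' P0 trP.
have {}P0 : #|P|%:R != 0 :> C by rewrite pnatr_eq0 -lt0n.
set s := \sum_(i | P i) _ *: _.
have s_rho j : P j -> s *m rho j = lam j *: s.
  move=> Pj; rewrite mulmx_suml scaler_sumr.
  rewrite [RHS](reindex_inj (mI' _ Pj)) (eq_bigl _ _ (fun i => PM' i j Pj)).
  apply: eq_bigr => i Pi; rewrite -scalemxAl rhoM // lamM //.
  by rewrite scalerA; congr (_ *: _); field; rewrite !lam0.
have rho_s i : P i -> rho i *m s = lam i *: s.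
  move=> Pi; rewrite mulmx_sumr scaler_sumr.
  rewrite [RHS](reindex_inj (mI _ Pi)) (eq_bigl _ _ (fun j => PM i j Pi)).
  apply: eq_bigr => j Pj; rewrite -scalemxAr rhoM // lamM //.
  by rewrite scalerA; congr (_ *: _); field; rewrite !lam0.
have fixed k (x : 'M[C]_(k, n)) :
    (forall i, P i -> x *m rho i = lam i *: x) -> x *m s = #|P|%:R *: x.
  move=> xE; rewrite mulmx_sumr.
  rewrite (eq_bigr (fun=> x)) ?sumr_const ?scaler_nat // => i Pi.
  by rewrite -scalemxAr xE // scalerA mulVf ?scale1r ?lam0.
have [||v [l [def_e lv]]] := @idempotent_trace1 C n (#|P|%:R^-1 *: s).
- rewrite -scalemxAl -scalemxAr (fixed _ _ s_rho) !scalerA.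
  by congr (_ *: _); field.
- rewrite mxtraceZ raddf_sum /= (eq_bigr (fun i => (lam i)^-1 * \tr (rho i))).
    by rewrite trP mulVf.
  by move=> i _; rewrite mxtraceZ.
have {}def_e : s = #|P|%:R *: (v *m l) by rewrite -def_e scalerA divff ?scale1r.
have cancel_l k : injective (@mulmx _ k 1 n ^~ l).
  move=> x y /(congr1 (mulmx ^~ v)) /=.
  by rewrite -!mulmxA lv !mulmx1.
have lE : l = #|P|%:R^-1 *: (l *m s).
  by rewrite def_e -scalemxAr scalerA mulVf // scale1r mulmxA lv mul1mx.
have vE : v = #|P|%:R^-1 *: (s *m v).
  by rewrite def_e -scalemxAl scalerA mulVf // scale1r -mulmxA lv mulmx1.
exists v, l; split=> //.
- move=> i Pi; rewrite {1}lE -scalemxAl -mulmxA s_rho // -scalemxAr.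
  by rewrite scalerA mulrC -scalerA -lE.
- move=> i Pi; rewrite {1}vE -scalemxAr mulmxA rho_s // -scalemxAl.
  by rewrite scalerA mulrC -scalerA -vE.
move=> x /fixed; rewrite def_e -scalemxAr => /(scalerI P0) xE.
by rewrite -{1}xE mulmxA {1}[x *m v]mx11_scalar mul_scalar_mx.
Qed.

(** * Cubic extensions of finite fields *)

(** The class of the variable in the field F[X]/(p), which has q^deg(p)
    elements, is fixed by raising to that power. *)
Lemma irreducible_dvd_genPoly (F : finFieldType) (p : {poly F}) :
  irreducible_poly p -> p \is monic ->
  p %| 'X^(#|F| ^ (size p).-1) - 'X.
Proof.
move=> p_irr p_mon.
pose hI : monic_irreducible_poly p := (p_irr, p_mon).
have /(congr1 (@polyn _ _)) := expf_card (in_qpoly p 'X : {poly %/ p with hI}).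
rewrite card_qfpoly.
have -> : (in_qpoly p 'X : {poly %/ p with hI}) ^+ (#|F| ^ (size p).-1)
          = in_qpoly p ('X^(#|F| ^ (size p).-1)) by rewrite rmorphXn.
rewrite /= (mk_monicE hI) => eX.
by rewrite dvdpE /Pdiv.Ring.rdvdp Pdiv.RingMonic.rmodpB // eX subrr.
Qed.

Lemma char_poly_tr (R : comNzRingType) n (A : 'M[R]_n) :
  char_poly A^T = char_poly A.
Proof.
by rewrite /char_poly -det_tr /char_poly_mx linearB /= tr_scalar_mx map_trmx trmxK.
Qed.

Section CubicExtension.
Variables (F : finFieldType) (E : fieldExtType F).
Hypothesis degE : \dim {:E} = 3%N.

Local Notation q := #|F|.

Lemma frobD (x y : E) : (x + y) ^+ q = x ^+ q + y ^+ q.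
Proof.
have [p _ pcharFp] := finPcharP F; rewrite (card_pprimeChar pcharFp).
have pcharEp : p \in [pchar E] by rewrite pchar_lalg.
apply: exprDn_pchar; rewrite pnatX (eq_pnat _ (pcharf_eq pcharEp)).
by rewrite pnat_id ?(pcharf_prime pcharFp).
Qed.

Lemma frob_sum n (G : 'I_n -> E) : (\sum_i G i) ^+ q = \sum_i G i ^+ q.
Proof.
apply: (big_morph _ frobD); rewrite expr0n.
by case: q (finNzRing_gt1 F).
Qed.

Lemma root_frob (f : {poly F}) (x : E) :
  root (map_poly (in_alg E) f) x -> root (map_poly (in_alg E) f) (x ^+ q).
Proof.
suff h : (map_poly (in_alg E) f).[x ^+ q] = (map_poly (in_alg E) f).[x] ^+ q.
  by rewrite !rootE h => /eqP ->; rewrite expr0n; case: q (finNzRing_gt1 F).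
rewrite !horner_coef frob_sum; apply: eq_bigr => i _.
rewrite exprMn exprAC; congr (_ * _).
by rewrite coef_map /= exprZn expr1n expf_card.
Qed.

Lemma expf_card3 (x : E) : x ^+ (q ^ 3) = x.
Proof.
have := Fermat's_little_theorem {:E}%AS x.
by rewrite memvf /= degE => /esym/eqP.
Qed.

Lemma frob_fixed (x : E) : x ^+ q = x -> exists a : F, x = a%:A.
Proof.
move=> xq; have := Fermat's_little_theorem 1%AS x.
rewrite /= dimv1 expn1 xq eqxx => /vlineP[a ->].
by exists a.
Qed.

Lemma frob_fixed_alg (a : F) : (a%:A : E) ^+ q = a%:A.
Proof. by rewrite exprZn expr1n expf_card. Qed.

Definition frob_conjugates (x : E) := [:: x; x ^+ q; x ^+ (q ^ 2)].

Lemma conjugates_uniq (x : E) : x ^+ q != x -> uniq (frob_conjugates x).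
Proof.
move=> xq; rewrite /= !inE negb_or eq_sym xq /=.
have q3 : x ^+ (q ^ 2) ^+ q = x by rewrite -exprM -expnSr expf_card3.
have xq2 : x ^+ (q ^ 2) != x by apply: contra xq => /eqP {1}<-; rewrite q3.
rewrite eq_sym xq2 /= andbT; apply: contra xq2 => /eqP e.
by rewrite -[eqbRHS]q3 -e -exprM mulnn e.
Qed.

Lemma root_conjugates (f : {poly F}) (x : E) :
  root (map_poly (in_alg E) f) x ->
  all (root (map_poly (in_alg E) f)) (frob_conjugates x).
Proof.
move=> fx /=; have fxq := root_frob fx; rewrite fx fxq /= andbT.
by rewrite expnSr exprM expn1 root_frob.
Qed.

(** The three Frobenius conjugates of a root outside F are distinct roots. *)
Lemma cubic_root_factor (f : {poly F}) (x : E) :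
  f \is monic -> size f = 4%N -> x ^+ q != x ->
  root (map_poly (in_alg E) f) x ->
  map_poly (in_alg E) f = \prod_(z <- frob_conjugates x) ('X - z%:P).
Proof.
move=> f_mon f4 xq fx.
rewrite [LHS](@all_roots_prod_XsubC _ _ (frob_conjugates x)).
- by rewrite (monicP _) ?scale1r // monic_map.
- by rewrite size_map_poly f4.
- exact: root_conjugates.
by rewrite uniq_rootsE conjugates_uniq.
Qed.

Definition field_char_poly (x : E) : {poly F} :=
  char_poly (mxof (vbasis {:E}) (vbasis {:E}) (amull x)).

Lemma field_char_poly_monic x : field_char_poly x \is monic.
Proof. exact: char_poly_monic. Qed.

Lemma size_field_char_poly x : size (field_char_poly x) = 4%N.
Proof. by rewrite size_char_poly degE. Qed.

Lemma field_char_poly_alg (a : F) :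
  field_char_poly a%:A = ('X - a%:P) ^+ 3.
Proof.
rewrite /field_char_poly.
have -> : amull (a%:A : E) = a *: \1%VF.
  by apply/lfunP => y; rewrite !lfunE /= lfunE /= -scalerAl mul1r.
rewrite linearZ /= mxof1 ?(basis_free (vbasisP _)) //.
rewrite scalemx1 /char_poly /char_poly_mx map_scalar_mx /= -raddfB /=.
by rewrite det_scalar degE.
Qed.

(** The column of the basis vectors, with entries in E, is an eigenvector of
    the matrix of multiplication by [x], for the eigenvalue [x]. *)
Lemma root_field_char_poly (x : E) :
  root (map_poly (in_alg E) (field_char_poly x)) x.
Proof.
rewrite /field_char_poly; set M := mxof _ _ _.
pose b : 'cV[E]_(\dim {:E}) := \col_i (vbasis {:E})`_i.
have Mb : map_mx (in_alg E) M *m b = x *: b.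
  apply/colP => i; rewrite !mxE.
  have := vecof_delta (vbasis {:E}) i => <-.
  have -> : x * vecof (vbasis {:E}) (delta_mx 0 i)
          = amull x (vecof (vbasis {:E}) (delta_mx 0 i)) by rewrite lfunE.
  rewrite (hom_vecof _ (vbasisP _)) -rowE; apply: eq_bigr => j _.
  by rewrite !mxE /= -scalerAl mul1r.
have b0 : b != 0.
  apply/eqP => b0; have i0 : 'I_(\dim {:E}) by rewrite degE; exact: ord0.
  have /(congr1 (fun M : 'cV_ _ => M i0 0)) := b0; rewrite !mxE => bi0.
  suff : (vbasis {:E})`_i0 != 0 by rewrite bi0 eqxx.
  by rewrite (basis_not0 (vbasisP {:E})) // mem_nth // size_tuple.
rewrite map_char_poly /= -char_poly_tr -eigenvalue_root_char.
apply/eigenvalueP; exists b^T; last by rewrite -trmx_eq0 trmxK.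
by rewrite -trmx_mul Mb linearZ.
Qed.

Lemma field_char_polyE (x : E) :
  map_poly (in_alg E) (field_char_poly x)
  = \prod_(z <- frob_conjugates x) ('X - z%:P).
Proof.
have [/frob_fixed[a ->]|xq] := eqVneq (x ^+ q) x; last first.
  apply: cubic_root_factor => //; last exact: root_field_char_poly.
    exact: field_char_poly_monic.
  exact: size_field_char_poly.
rewrite field_char_poly_alg rmorphXn /= map_polyXsubC /= !big_cons big_nil.
by rewrite expnSr expn1 exprM !frob_fixed_alg mulr1 !exprS expr0 mulr1.
Qed.

Lemma field_normE (x : E) : (field_norm x)%:A = x ^+ (1 + q + q ^ 2).
Proof.
have := congr1 (fun f : {poly E} => f`_0) (field_char_polyE x).
rewrite coef_map /= char_poly_det -horner_coef0 !big_cons big_nil !hornerE.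
have -> : (-1) ^+ \dim {:E} = -1 :> F by rewrite degE; ring.
rewrite mulN1r scaleNr => /(congr1 -%R); rewrite opprK => ->.
rewrite /= !exprD expr1; ring.
Qed.

Lemma field_char_poly_root (f : {poly F}) (x : E) :
  f \is monic -> size f = 4%N -> x ^+ q != x ->
  root (map_poly (in_alg E) f) x -> f = field_char_poly x.
Proof.
move=> f_mon f4 xq fx; apply: (map_poly_inj (in_alg E)).
by rewrite field_char_polyE; apply: cubic_root_factor.
Qed.

Lemma frob_conjugate (x z : E) :
  z \in frob_conjugates x -> (z ^+ q == z) = (x ^+ q == x).
Proof.
rewrite !inE => /or3P[] /eqP-> //.
  have [xq | xq] := eqVneq (x ^+ q) x; first by rewrite !xq eqxx.
  have := conjugates_uniq xq; rewrite /= !inE -exprM mulnn negb_or.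
  by case/and3P=> _; rewrite eq_sym => /negbTE.
rewrite -exprM -expnSr expf_card3.
have [xq | xq] := eqVneq (x ^+ q) x; first by rewrite -mulnn exprM !xq eqxx.
by have := conjugates_uniq xq; rewrite /= !inE negb_or => /andP[/andP[_ /negbTE]].
Qed.

Lemma field_char_poly_conjugate (x z : E) : x ^+ q != x ->
  (field_char_poly z == field_char_poly x) = (z \in frob_conjugates x).
Proof.
move=> xq; apply/eqP/idP => [e|zx].
  have := root_field_char_poly z.
  by rewrite e field_char_polyE root_prod_XsubC.
symmetry; apply: field_char_poly_root; rewrite ?frob_conjugate //.
- exact: field_char_poly_monic.
- exact: size_field_char_poly.
- by rewrite (frob_conjugate zx).
by rewrite field_char_polyE root_prod_XsubC.
Qed.

Lemma field_char_poly_irr (x : E) :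
  x ^+ q != x -> irreducible_poly (field_char_poly x).
Proof.
move=> xq; apply: cubic_irreducible; first by rewrite size_field_char_poly.
move=> a; apply/negP => fa.
have : root (map_poly (in_alg E) (field_char_poly x)) (in_alg E a).
  by rewrite fmorph_root.
rewrite field_char_polyE root_prod_XsubC => /frob_conjugate.
by rewrite frob_fixed_alg eqxx (negPf xq).
Qed.

(** Such a polynomial divides X^(q^3) - X, whose roots are the elements
    of E. *)
Lemma irreducible_cubic_root (f : {poly F}) :
  irreducible_poly f -> f \is monic -> size f = 4%N ->
  exists2 x : E, x ^+ q != x & f = field_char_poly x.
Proof.
move=> f_irr f_mon f4.
suff [x fx] : exists x : E, root (map_poly (in_alg E) f) x.
  have xq : x ^+ q != x.
    apply/eqP => /frob_fixed[a xa]; move: fx; rewrite xa fmorph_root.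
    rewrite -dvdp_XsubCl => /f_irr.2; rewrite size_XsubC => /(_ isT).
    by move=> /eqp_size; rewrite size_XsubC f4.
  by exists x => //; apply: field_char_poly_root.
have := irreducible_dvd_genPoly f_irr f_mon; rewrite f4 /=.
have cardE : #|finvect_type E| = (q ^ 3)%N.
  have := card_vspace (fullv : {vspace finvect_type E}).
  by rewrite [in RHS]degE => <-; apply: eq_card => x; rewrite memvf.
rewrite -(dvdp_map (in_alg E)) rmorphB /= map_polyXn map_polyX -cardE.
rewrite (@finField_genPoly (finvect_type E)).
case/dvdp_prod_XsubC => m fE; move: (eqp_size fE) (eqp_root fE).
rewrite size_map_poly f4 size_prod_XsubC; case: mask => [|x s] //= _ fx.
by exists x; rewrite fx root_prod_XsubC mem_head.
Qed.

End CubicExtension.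

(** * Explicit 3 x 3 matrices *)

Lemma det_mx2 (R : comNzRingType) (M : 'M[R]_2) :
  \det M = M 0 0 * M 1 1 - M 0 1 * M 1 0.
Proof.
rewrite (expand_det_row _ 0) !big_ord_recl big_ord0 /cofactor !det_mx11 !mxE.
rewrite /= addr0 expr0 expr1 !mul1r mulN1r mulrN.
by congr (M _ _ * M _ _ - M _ _ * M _ _); apply: val_inj.
Qed.

Lemma det_mx3 (R : comNzRingType) (M : 'M[R]_3) (i := 0) (j := 1) (k := 2) :
  \det M = M i i * (M j j * M k k - M j k * M k j)
         - M i j * (M j i * M k k - M j k * M k i)
         + M i k * (M j i * M k j - M j j * M k i).
Proof.
rewrite (expand_det_row _ 0) !big_ord_recl big_ord0 /cofactor !det_mx2 !mxE.
pose m a b := M (inord a) (inord b).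
have mE r s : M r s = m r s by rewrite /m !inord_val.
rewrite !mE /= /bump /= !expr1 expr0 ?addn0 ?add0n /=; ring.
Qed.

Lemma minor2_rank (K : fieldType) m n (M : 'M[K]_(m, n)) i i' j j' :
  M i j * M i' j' - M i j' * M i' j != 0 -> (2 <= \rank M)%N.
Proof.
pose f (a : 'I_2) := if a == 0 then i else i'.
pose g (a : 'I_2) := if a == 0 then j else j'.
have -> : M i j * M i' j' - M i j' * M i' j = \det (mxsub f g M).
  by rewrite det_mx2 !mxE.
rewrite -unitfE -unitmxE => /mxrank_unit {1}<-.
have -> : mxsub f g M = rowsub f (colsub g M) by rewrite -mxsubrc.
apply: leq_trans (mxrankS (rowsub_sub _ _)) _.
rewrite -mxrank_tr trmx_mxsub -[leqRHS]mxrank_tr.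
exact: mxrankS (rowsub_sub _ _).
Qed.

Section Matrix3.
Variable F : finFieldType.

Definition mx3 (a b c d e f g h i : F) : 'M[F]_3 :=
  mx_of_rows [:: [:: a; b; c]; [:: d; e; f]; [:: g; h; i]].

Lemma mx3M (a b c d e f g h i a' b' c' d' e' f' g' h' i' : F) :
  mx3 a b c d e f g h i *m mx3 a' b' c' d' e' f' g' h' i' =
  mx3 (a * a' + b * d' + c * g') (a * b' + b * e' + c * h')
      (a * c' + b * f' + c * i')
      (d * a' + e * d' + f * g') (d * b' + e * e' + f * h')
      (d * c' + e * f' + f * i')
      (g * a' + h * d' + i * g') (g * b' + h * e' + i * h')
      (g * c' + h * f' + i * i').
Proof.
apply/matrixP => r s; rewrite !mxE !big_ord_recl big_ord0 !mxE.
by case: r => [[|[|[|//]]] ?]; case: s => [[|[|[|//]]] ?];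
   rewrite /= addr0 addrA.
Qed.

Lemma det_mx3E (a b c d e f g h i : F) :
  \det (mx3 a b c d e f g h i)
  = a * (e * i - f * h) - b * (d * i - f * g) + c * (d * h - e * g).
Proof. by rewrite det_mx3 !mxE. Qed.

Lemma char_poly_mx3 (a b c d e f g h i : F) :
  char_poly (mx3 a b c d e f g h i)
  = 'X^3 - (a + e + i)%:P * 'X^2
    + (a * e - b * d + a * i - c * g + e * i - f * h)%:P * 'X
    - (a * (e * i - f * h) - b * (d * i - f * g) + c * (d * h - e * g))%:P.
Proof.
rewrite /char_poly det_mx3 !mxE /= !(rmorphB, rmorphD, rmorphM) /=; ring.
Qed.

Lemma char_poly_mx3_coef (a b c d e f g h i : F) :
  let p := char_poly (mx3 a b c d e f g h i) in
  [/\ p`_0 = - (a * (e * i - f * h) - b * (d * i - f * g) + c * (d * h - e * g)),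
      p`_1 = a * e - b * d + a * i - c * g + e * i - f * h,
      p`_2 = - (a + e + i) & p`_3 = 1].
Proof.
rewrite /= char_poly_mx3 !(coefD, coefN, coefC, coefCM, coefX, coefXn) /=.
by split; ring.
Qed.

Lemma size4_polyP (p r : {poly F}) : size p = 4 -> size r = 4 ->
  p`_0 = r`_0 -> p`_1 = r`_1 -> p`_2 = r`_2 -> p`_3 = r`_3 -> p = r.
Proof.
move=> p4 r4 e0 e1 e2 e3; apply/polyP => -[|[|[|[|i]]]] //.
by rewrite !nth_default ?p4 ?r4.
Qed.

End Matrix3.

Ltac mx3_eq := rewrite ?mx3M; congr mx3; ring.

Section Families.
Variable F : finFieldType.
Implicit Types a b g h x y z w : F.

Definition unip x y w : 'M[F]_3 := mx3 1 x y 0 1 w 0 0 1.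
(** The product of [cyc g 0 0 0], a monomial matrix over the 3-cycle, and
    [unip x y w] (see [cyc_unip]). *)
Definition cyc g x y w : 'M[F]_3 := mx3 0 0 1 g (g * x) (g * y) 0 g (g * w).
(** The product of [unip a b 0] and diag(g, g, 1). *)
Definition mira a b g : 'M[F]_3 := mx3 g (a * g) b 0 g 0 0 0 1.

Lemma unip_unit x y w : unip x y w \in unitmx.
Proof. by rewrite unitmxE det_mx3E !(mulr0, mul0r, mulr1, subr0, addr0) unitr1. Qed.

Lemma cyc_unit g x y w : g != 0 -> cyc g x y w \in unitmx.
Proof.
move=> g0; rewrite unitmxE det_mx3E unitfE !(mulr0, mul0r, mulr1, subr0, addr0).
by rewrite add0r mul1r mulf_neq0.
Qed.

Lemma mira_unit a b g : g != 0 -> mira a b g \in unitmx.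
Proof.
move=> g0; rewrite unitmxE det_mx3E unitfE !(mulr0, mul0r, mulr1, subr0, addr0).
by rewrite mulf_neq0.
Qed.

Lemma unipM x y w x' y' w' :
  unip x y w *m unip x' y' w' = unip (x + x') (y + y' + x * w') (w + w').
Proof. by mx3_eq. Qed.

Lemma miraM a b g a' b' g' :
  mira a b g *m mira a' b' g' = mira (a + a') (b + g * b') (g * g').
Proof. by mx3_eq. Qed.

Lemma cyc_unip g x y w : cyc g 0 0 0 *m unip x y w = cyc g x y w.
Proof. by mx3_eq. Qed.

(** This and the next identity are what makes the two periods equivariant: the
    unipotent factor on the right moves to the left, where a Whittaker
    functional absorbs it, and leaves only its entry [a]. *)
Lemma diag_mira g a b h :
  diag_ggo g *m mira a b h = unip a (g * b) 0 *m diag_ggo (g * h).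
Proof. by rewrite /diag_ggo -!/(mx3 _ _ _ _ _ _ _ _ _); mx3_eq. Qed.

Lemma cyc_mira g z a b h : h != 0 ->
  cyc g 0 z 0 *m mira a b h = unip 0 0 a *m cyc (g * h) 0 ((b + z) / h) 0.
Proof. by move=> h0; rewrite ?mx3M; congr mx3; field. Qed.

(** The factor psi (z a) that comes out on the left is the kernel of the
    Fourier transform. *)
Lemma cyc_lower g z a : g != 0 ->
  cyc g 0 z 0 *m lower_z a = unip 0 (a / g) (z * a) *m cyc g 0 z 0.
Proof.
move=> g0; rewrite /lower_z -!/(mx3 _ _ _ _ _ _ _ _ _).
by rewrite ?mx3M; congr mx3; field.
Qed.

Lemma char_poly_unip x y w : char_poly (unip x y w) = ('X - 1%:P) ^+ 3.
Proof. by rewrite char_poly_mx3 !(rmorphB, rmorphD, rmorphM) /=; ring. Qed.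

Lemma char_poly_mira a b g :
  char_poly (mira a b g) = ('X - g%:P) ^+ 2 * ('X - 1%:P).
Proof. by rewrite char_poly_mx3 !(rmorphB, rmorphD, rmorphM) /=; ring. Qed.

Lemma rank_unip_sub1 x y w :
  \rank (unip x y w - 1%:M) =
  if x * w != 0 then 2%N else ((x, y, w) != (0, 0, 0)).
Proof.
set N := _ - _.
have NE : N = mx3 0 x y 0 0 w 0 0 0.
  apply/matrixP => -[[|[|[|//]]] ?] [[|[|[|//]]] ?];
  by rewrite !mxE /= ?subrr ?subr0.
case: ifP => [xw | /negbFE/eqP xw].
  apply/eqP; rewrite eqn_leq; apply/andP; split; last first.
    apply: (@minor2_rank _ _ _ _ 0 1 1 2).
    by rewrite NE !mxE /= mulr0 subr0.
  rewrite NE leqNgt; apply/negP => N3.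
  have : row_full (mx3 0 x y 0 0 w 0 0 0).
    by rewrite /row_full eqn_leq rank_leq_col N3.
  by rewrite row_full_unit unitmxE det_mx3E unitfE !(mulr0, mul0r, subrr, addr0) eqxx.
have N0 : (N == 0) = ((x, y, w) == (0, 0, 0)).
  apply/eqP/eqP => [/matrixP N0|]; last first.
    rewrite NE => -[-> -> ->].
    by apply/matrixP => -[[|[|[|//]]] ?] [[|[|[|//]]] ?]; rewrite !mxE.
  move: (N0 0 1) (N0 0 2) (N0 1 2); rewrite NE !mxE /= => x0 y0 w0.
  by rewrite x0 y0 w0.
rewrite -N0; have [->|N_neq0] := eqVneq N 0; first by rewrite mxrank0.
apply/eqP; rewrite eqn_leq lt0n mxrank_eq0 N_neq0 andbT.
have [u [v ->]] : exists (u : 'cV[F]_3) (v : 'rV[F]_3), N = u *m v.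
  move/eqP: xw; rewrite mulf_eq0 => /orP[] /eqP z0.
    exists (\col_i [:: y; w; 0]`_i), (\row_i [:: 0; 0; 1]`_i).
    rewrite NE z0; apply/matrixP => -[[|[|[|//]]] ?] [[|[|[|//]]] ?];
    by rewrite !mxE big_ord1 !mxE /= ?mulr0 ?mulr1.
  exists (\col_i [:: 1; 0; 0]`_i), (\row_i [:: 0; x; y]`_i).
  rewrite NE z0; apply/matrixP => -[[|[|[|//]]] ?] [[|[|[|//]]] ?];
  by rewrite !mxE big_ord1 !mxE /= ?mul0r ?mul1r.
exact: leq_trans (mxrankM_maxl _ _) (rank_leq_col _).
Qed.

(** The eigenspaces of [cyc g x y w] are lines: the minor of rows 2, 3 and
    columns 1, 2 is g^2, whatever the eigenvalue. *)
Lemma rank_cyc_sub (E : fieldExtType F) (g x y w : F) (alpha : E) : g != 0 ->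
  (2 <= \rank (map_mx (in_alg E) (cyc g x y w) - alpha%:M)%R)%N.
Proof.
move=> g0; apply: (@minor2_rank E 3 3 _ 1 2 0 1).
rewrite !mxE /= !mulr0n !subr0 scale0r mulr0 subr0.
by rewrite mulf_neq0 ?scaler_eq0 ?oner_eq0 ?orbF.
Qed.

End Families.

(** * Traces of the representation *)

Lemma GL_of_mxM (F : finFieldType) (M N : 'M[F]_3) :
  M \in unitmx -> N \in unitmx ->
  GL_of_mx (M *m N) = (GL_of_mx M * GL_of_mx N)%g.
Proof.
move=> uM uN; apply: val_inj.
change (GLval (GL_of_mx (M *m N)) = GLval (GL_of_mx M) *m GLval (GL_of_mx N)).
by rewrite !GLval_of_mx ?unitmx_mul ?uM.
Qed.

Lemma GL_of_mxK (F : finFieldType) (u : {'GL_3[F]}) : GL_of_mx (GLval u) = u.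
Proof. by apply: val_inj; apply: GLval_of_mx; exact: (valP u). Qed.

(** Indexing the operators by matrices rather than by group elements makes
    identities between explicit matrices directly usable. *)
Definition mxrep (F : finFieldType) (C : fieldType) n
    (rG : mx_representation C [set: {'GL_3[F]}] n) (M : 'M[F]_3) :=
  rG (GL_of_mx M).

Lemma mxrepM (F : finFieldType) (C : fieldType) n
    (rG : mx_representation C [set: {'GL_3[F]}] n) (M N : 'M[F]_3) :
  M \in unitmx -> N \in unitmx ->
  mxrep rG M *m mxrep rG N = mxrep rG (M *m N).
Proof. by move=> uM uN; rewrite /mxrep GL_of_mxM // repr_mxM ?inE. Qed.

Section Traces.
Variables (F : finFieldType) (C : numFieldType) (n : nat).
Variable rG : mx_representation C [set: {'GL_3[F]}] n.
Local Notation rho := (mxrep rG).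
Local Notation q := (#|F|%:R : C).

Variables (E : fieldExtType F) (degE : \dim {:E} = 3%N) (theta : E -> C).
Hypothesis theta_mul : multiplicative_character theta.
Hypothesis rG_theta : associated_with theta rG.

Lemma tr_mxrep (M : 'M[F]_3) (p : {poly F}) m d (alpha : E) :
  M \in unitmx -> irreducible_poly p -> size p = d.+1 ->
  char_poly M = p ^+ m -> root (map_poly (in_alg E) p) alpha ->
  \tr (rho M) = (\sum_(0 <= i < d) theta (alpha ^+ (#|F| ^ i))) *
     \prod_(1 <= j < 3 - \rank (map_mx (in_alg E) M - alpha%:M))
        (1 - (#|F| ^ (d * j))%:R).
Proof.
move=> uM p_irr sz_p Mp palpha.
have m_gt0 : (0 < m)%N.
  case: m Mp => // Mp; have := size_char_poly M.
  by rewrite Mp expr0 size_poly1.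
rewrite ((rG_theta.2 (GL_of_mx M) p m d alpha) p_irr sz_p).
- by rewrite GLval_of_mx // mxrank_ker expr2 mulrNN mulr1 mul1r.
- by rewrite GLval_of_mx.
rewrite GLval_of_mx // eigenvalue_root_char -map_char_poly Mp rmorphXn /=.
by rewrite /root hornerE expf_eq0 m_gt0.
Qed.

Lemma tr_mxrep0 (M : 'M[F]_3) : M \in unitmx ->
  (forall p m, irreducible_poly p -> char_poly M <> p ^+ m) -> \tr (rho M) = 0.
Proof. by move=> uM h; apply: rG_theta.1; rewrite GLval_of_mx. Qed.

Lemma tr_unip x y w :
  \tr (rho (unip x y w)) =
  if x * w != 0 then 1 else if (x, y, w) == (0, 0, 0) then (1 - q) * (1 - q ^+ 2)
  else 1 - q.
Proof.
rewrite (@tr_mxrep _ ('X - 1%:P) 3 1 1) ?unip_unit ?char_poly_unip ?size_XsubC //.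
- rewrite big_nat1 expr1n theta_mul.1 mul1r.
  rewrite -(rmorph1 (in_alg E)) -map_scalar_mx -map_mxB mxrank_map rank_unip_sub1.
  have [xw | xw] := boolP (x * w != 0); first by rewrite big_geq.
  rewrite /=; case: eqP => _ /=; last by rewrite big_nat1 mul1n expn1.
  by rewrite big_ltn // big_nat1 !mul1n expn1 natrX.
- split; first by rewrite size_XsubC.
  move=> r r1 r_dv; exact: (irredp_XsubC 1).2.
by rewrite map_polyXsubC /= scale1r root_XsubC.
Qed.

(** Both 1 and [g] are roots of the characteristic polynomial, which is
    therefore not a power of an irreducible polynomial. *)
Lemma tr_mira a b g : g != 0 -> g != 1 -> \tr (rho (mira a b g)) = 0.
Proof.
move=> g0 g1; apply: tr_mxrep0; first exact: mira_unit.
move=> p m p_irr; rewrite char_poly_mira => e.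
have rt c : root (('X - g%:P) ^+ 2 * ('X - 1%:P)) c -> p %= 'X - c%:P.
  rewrite e => pc; rewrite eqp_sym; apply: p_irr.2; first by rewrite size_XsubC.
  rewrite dvdp_XsubCl; move: pc; rewrite !rootE horner_exp expf_eq0.
  by case/andP.
have p1 : p %= 'X - 1%:P by apply: rt; rewrite rootM root_XsubC eqxx orbT.
have pg : p %= 'X - g%:P.
  by apply: rt; rewrite rootM rootE horner_exp hornerXsubC subrr expr0n eqxx.
have /eqp_root/(_ 1) : 'X - 1%:P %= 'X - g%:P by rewrite -(eqp_ltrans p1).
by rewrite !root_XsubC eqxx eq_sym (negPf g1).
Qed.

(** Eigenspaces are lines, so only the sum over conjugates survives in the
    character formula.  If the characteristic polynomial is irreducible, the
    three conjugates are the elements of E that have it; if it is a cube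
    (X - a)^3, the only such element is a; otherwise it is not a power of an
    irreducible polynomial, no element of E has it, and both sides are 0. *)
Lemma tr_cyc g x y w : g != 0 ->
  \tr (rho (cyc g x y w)) =
  \sum_(xi : finvect_type E | field_char_poly (xi : E) == char_poly (cyc g x y w))
     theta (xi : E).
Proof.
move=> g0; set M := cyc g x y w; have uM : M \in unitmx by apply: cyc_unit.
have rank_M (alpha : E) (c : nat -> C) :
    \prod_(1 <= j < 3 - \rank (map_mx (in_alg E) M - alpha%:M)) c j = 1.
  have := rank_cyc_sub x y w alpha g0; rewrite -/M.
  by case: (\rank _) => [|[|[|[|r]]]] // _; rewrite big_geq.
have M_mon := char_poly_monic M; have M4 := size_char_poly M.
have [/existsP[xi /eqP xiM]|/existsPn noxi] := boolP
    [exists xi : finvect_type E, field_char_poly (xi : E) == char_poly M]; last first.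
  rewrite big_pred0 => [|xi]; last exact/negbTE.
  apply: tr_mxrep0 => // p m p_irr Mp.
  have sz_p : ((size p).-1 * m = 3)%N by rewrite -size_exp -Mp M4.
  have : (m %| 3)%N by rewrite -sz_p dvdn_mull.
  rewrite dvdn_divisors // !inE => /orP[] /eqP m_eq.
    rewrite m_eq expr1 in Mp; rewrite -Mp in p_irr.
    have [xi _ xiM] := irreducible_cubic_root degE p_irr M_mon M4.
    by have := noxi xi; rewrite -xiM eqxx.
  have [|a pa] := @poly2_root _ p.
    by move: sz_p; rewrite m_eq; case: size => [|[|[|s]]].
  have /(eqp_exp m) : 'X - a%:P %= p.
    by apply: p_irr.2; rewrite ?size_XsubC ?dvdp_XsubCl.
  rewrite -Mp m_eq eqp_monic ?monic_exp ?monicXsubC // => /eqP aM.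
  by have := noxi a%:A; rewrite -aM (field_char_poly_alg degE) eqxx.
have [/frob_fixed[a xi_a]|xiq] := eqVneq ((xi : E) ^+ #|F|) xi.
  rewrite xi_a (field_char_poly_alg degE) in xiM.
  rewrite (@tr_mxrep M ('X - a%:P) 3 1 xi) ?size_XsubC //.
  - rewrite rank_M mulr1 big_nat1 expr1 (big_pred1 xi) // => z.
    apply/eqP/eqP => [zM|->]; last by rewrite xi_a (field_char_poly_alg degE).
    have := root_field_char_poly degE (z : E).
    rewrite zM -xiM rmorphXn /= map_polyXsubC rootE horner_exp hornerXsubC.
    by rewrite expf_eq0 subr_eq0 /= -xi_a => /eqP.
  - by split; [rewrite size_XsubC | exact: (irredp_XsubC a).2].
  by rewrite map_polyXsubC root_XsubC xi_a.
rewrite (@tr_mxrep M (char_poly M) 1 3 xi) //.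
- rewrite rank_M mulr1.
  rewrite (eq_bigl (fun z : finvect_type E => (z : E) \in frob_conjugates (xi : E))); last first.
    by move=> z; rewrite -xiM (field_char_poly_conjugate degE _ xiq).
  rewrite -big_uniq ?(conjugates_uniq degE xiq) //=.
  by rewrite big_mkord !big_ord_recl big_ord0 !big_cons big_nil.
- by rewrite -xiM; apply: field_char_poly_irr.
by rewrite -xiM; apply: root_field_char_poly.
Qed.

End Traces.

(** * The character sum over the norm equation *)

Section NormSquare.
Variables (F : finFieldType) (E : fieldExtType F).
Hypothesis degE : \dim {:E} = 3%N.
Local Notation q := #|F|.

Lemma field_norm_sq (x : E) : field_norm (x ^+ 2) = field_norm x ^+ 2.
Proof.
apply: (fmorph_inj (in_alg E)).
by rewrite rmorphXn /= !(field_normE degE) -!exprM mulnC.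
Qed.

Lemma field_norm_eq0 (x : E) : (field_norm x == 0) = (x == 0).
Proof.
by rewrite -(fmorph_eq0 (in_alg E)) /= (field_normE degE) expf_eq0.
Qed.

Let k := ((q * q.+1)./2)%N.

Lemma half_q_q1 : (2 * k = q + q ^ 2)%N.
Proof.
rewrite /k mul2n -[RHS]odd_double_half -mulnn -mulnS.
by rewrite oddM oddS andbN add0n.
Qed.

(** The square root of [xi] whose norm is [g], when N xi = g^2.  Dividing
    g^2 = xi^(1 + q + q^2) by xi^(q + q^2) gives xi, and the exponent q + q^2 = 2 k
    is even for every q, so half of it gives a square root. *)
Definition norm_sqrt (xi : E) (g : F) : E := g%:A * xi ^- k.

Lemma norm_sqrtK (x : E) : x != 0 -> norm_sqrt (x ^+ 2) (field_norm x) = x.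
Proof.
move=> x0; rewrite /norm_sqrt (field_normE degE) -exprM half_q_q1 -addnA.
by rewrite exprD expr1 mulfK // expf_neq0.
Qed.

Section Sqrt.
Variables (xi : E) (g : F).
Hypotheses (g0 : g != 0) (gxi : g ^+ 2 = field_norm xi).

Lemma norm_square_neq0 : xi != 0.
Proof. by rewrite -field_norm_eq0 -gxi expf_neq0. Qed.

Lemma norm_sqrt_sq : norm_sqrt xi g ^+ 2 = xi.
Proof.
rewrite /norm_sqrt exprMn -exprVn -exprM mulnC half_q_q1.
have -> : (g%:A : E) ^+ 2 = (field_norm xi)%:A by rewrite -gxi exprZn expr1n.
rewrite (field_normE degE) -addnA exprD expr1 exprVn mulfK //.
by rewrite expf_neq0 // norm_square_neq0.
Qed.

Lemma norm_sqrt_norm : field_norm (norm_sqrt xi g) = g.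
Proof.
apply: (fmorph_inj (in_alg E)); rewrite /= (field_normE degE).
have gE0 : (g%:A : E) != 0 by rewrite scaler_eq0 oner_eq0 orbF.
have gq : (g%:A : E) ^+ (q + q ^ 2) = g%:A ^+ 2.
  by rewrite exprD -mulnn exprM !frob_fixed_alg expr2.
have xiq : xi ^+ (1 + q + q ^ 2) = g%:A ^+ 2.
  by rewrite -(field_normE degE) -gxi exprZn expr1n.
rewrite /norm_sqrt exprMn exprVn exprAC xiq -exprM half_q_q1 gq.
by rewrite -addnA exprD expr1 gq mulfK ?expf_neq0.
Qed.
End Sqrt.
End NormSquare.

Lemma field_char_poly_cyc (F : finFieldType) (E : fieldExtType F)
    (degE : \dim {:E} = 3%N) (xi : E) (g x y w : F) :
  (field_char_poly xi == char_poly (cyc g x y w)) =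
  [&& g ^+ 2 == field_norm xi, g * (x + w) == field_trace xi &
      g ^+ 2 * (x * w - y) == (field_char_poly xi)`_1].
Proof.
have [c0 c1 c2 c3] := char_poly_mx3_coef 0 0 1 g (g * x) (g * y) 0 g (g * w).
have f0 : (field_char_poly xi)`_0 = - field_norm xi.
  rewrite char_poly_det; have -> : (-1) ^+ \dim {:E} = -1 :> F by rewrite degE; ring.
  by rewrite mulN1r.
have f2 : (field_char_poly xi)`_2 = - field_trace xi.
  rewrite /field_char_poly /field_trace -char_poly_trace ?degE //.
  by congr (_`_ _); rewrite degE.
have f3 : (field_char_poly xi)`_3 = 1.
  by have /monicP := field_char_poly_monic xi; rewrite lead_coefE size_field_char_poly.
apply/eqP/and3P => [e|[/eqP e0 /eqP e2 /eqP e1]].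
  have := (f0, f2); rewrite e [_`_0]c0 [_`_2]c2 [_`_1]c1 => -[h0 h2]; split.
  - by rewrite -eqr_opp -h0; apply/eqP; ring.
  - by rewrite -eqr_opp -h2; apply/eqP; ring.
  by apply/eqP; ring.
apply: size4_polyP; rewrite ?size_field_char_poly ?size_char_poly //.
- by rewrite f0 -e0 [RHS]c0; ring.
- by rewrite -e1 [RHS]c1; ring.
- by rewrite f2 -e2 [RHS]c2; ring.
by rewrite f3 [RHS]c3.
Qed.

Lemma additive_characterN (F C : fieldType) (psi : F -> C) :
  additive_character psi -> forall x, psi (- x) = (psi x)^-1.
Proof.
move=> [psi0 psiD] x.
have e : psi (- x) * psi x = 1 by rewrite -psiD addNr.
have x0 : psi x != 0 by apply: contra_eq_neq e => ->; rewrite mulr0 eq_sym oner_eq0.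
by rewrite -[RHS]mul1r -e mulfK.
Qed.

Lemma additive_character_neq0 (F C : fieldType) (psi : F -> C) :
  additive_character psi -> forall x, psi x != 0.
Proof.
move=> psi_add x.
have e : psi (- x) * psi x = 1 by rewrite -psi_add.2 addNr psi_add.1.
by apply: contra_eq_neq e => ->; rewrite mulr0 eq_sym oner_eq0.
Qed.

(** For fixed [xi] and [g] the three coefficients of the characteristic
    polynomial impose N xi = g^2, and then express [w] and [y] through the free
    entry [x], with x + w = Tr xi / g; this accounts for the factor q.  The
    remaining pairs (xi, g) are parametrized by (eta^2, N eta). *)
Lemma sum_cyc_char (F : finFieldType) (C : fieldType) (psi : F -> C)
    (E : fieldExtType F) (degE : \dim {:E} = 3%N) (theta : E -> C) :
  additive_character psi ->
  \sum_(g : F | g != 0) \sum_(t : F * (F * F))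
    (psi (t.1 + t.2.2))^-1 *
    (\sum_(xi : finvect_type E | field_char_poly (xi : E)
                                == char_poly (cyc g t.1 t.2.1 t.2.2)) theta (xi : E))
  = #|F|%:R * \sum_(xi : finvect_type E | xi != 0)
       psi (- (field_trace ((xi : E) ^+ 2) / field_norm (xi : E)))
       * theta ((xi : E) ^+ 2).
Proof.
move=> psi_add.
have inner (xi : E) g : g != 0 ->
    \sum_(t : F * (F * F) | field_char_poly xi == char_poly (cyc g t.1 t.2.1 t.2.2))
      (psi (t.1 + t.2.2))^-1
    = if g ^+ 2 == field_norm xi then #|F|%:R * psi (- (field_trace xi / g)) else 0.
  move=> g0; rewrite (eq_bigl _ _ (fun t => field_char_poly_cyc degE _ _ _ _ _)).
  case: eqP => gxi /=; last by rewrite big_pred0.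
  rewrite -(pair_big_dep xpredT (fun x p => (g * (x + p.2) == field_trace xi) &&
     (g ^+ 2 * (x * p.2 - p.1) == (field_char_poly xi)`_1))
     (fun x p => (psi (x + p.2))^-1)) /=.
  rewrite mulr_natl -sumr_const; apply: eq_bigr => x _.
  (* The trace gives w, and the middle coefficient then gives y. *)
  pose w := field_trace xi / g - x.
  rewrite (big_pred1 (x * w - (field_char_poly xi)`_1 / g ^+ 2, w)) /=.
    by rewrite -additive_characterN // /w; congr psi; rewrite addrC subrK.
  move=> -[y w'] /=; rewrite xpair_eqE andbC; apply/andP/andP => -[/eqP e1 /eqP e2].
    have w'E : w' = w by rewrite /w -e2; field.
    by split; apply/eqP => //; rewrite -w'E -e1; field.
  by rewrite e1 e2 /w; split; apply/eqP; field.
under eq_bigr => g g0.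
  under eq_bigr => t _ do rewrite mulr_sumr.
  rewrite (exchange_big_dep xpredT) //=.
  under eq_bigr => xi _ do rewrite -mulr_suml (inner _ _ g0).
  over.
rewrite exchange_big /= pair_big_dep /=.
rewrite (bigID (fun p : finvect_type E * F => p.2 ^+ 2 == field_norm (p.1 : E))) /=.
rewrite [X in _ + X]big1 ?addr0; last first.
  by move=> p /andP[_ /negPf->]; rewrite mul0r.
rewrite (reindex_onto
    (fun x : finvect_type E => ((x : E) ^+ 2 : finvect_type E, field_norm (x : E)))
    (fun p => norm_sqrt (p.1 : E) p.2 : finvect_type E)) /=; last first.
  move=> [xi g] /= /andP[g0 /eqP gxi].
  by rewrite norm_sqrt_sq // norm_sqrt_norm.
rewrite mulr_sumr; apply: eq_big => [x|x].
  rewrite field_norm_eq0 // field_norm_sq // eqxx andbT.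
  have [->|x0] := eqVneq x 0; first by [].
  by rewrite norm_sqrtK // eqxx.
by case/andP=> /andP[_ ->] _; rewrite mulrA.
Qed.

(** * Multiplicity one for the unipotent and mirabolic characters *)

Lemma sum_additive_characterV (F : finFieldType) (C : fieldType) (psi : F -> C) :
  additive_character psi -> (exists x, psi x != 1) -> \sum_x (psi x)^-1 = 0.
Proof.
move=> psi_add [a psi_a]; have psi0 := additive_character_neq0 psi_add.
have : (psi a)^-1 * (\sum_x (psi x)^-1) = \sum_x (psi x)^-1.
  rewrite mulr_sumr [RHS](reindex_inj (addrI a)); apply: eq_bigr => x _ /=.
  by rewrite psi_add.2 invfM.
move/eqP; rewrite -subr_eq0 -{2}[\sum_x _]mul1r -mulrBl mulf_eq0.
by rewrite subr_eq0 invr_eq1 (negPf psi_a) => /eqP.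
Qed.

Lemma sum_delta (F : finFieldType) (C : fieldType) (f : F -> C) :
  \sum_x (x == 0)%:R * f x = f 0.
Proof.
rewrite (bigD1 0) //= eqxx mul1r big1 ?addr0 // => x /negPf->.
by rewrite mul0r.
Qed.

Lemma sum_triple (F : finFieldType) (C : fieldType) (f : F -> F -> F -> C) :
  \sum_(t : F * (F * F)) f t.1 t.2.1 t.2.2 = \sum_x \sum_y \sum_w f x y w.
Proof.
rewrite -(pair_bigA _ (fun x p => f x p.1 p.2)) /=.
by apply: eq_bigr => x _; rewrite -(pair_bigA _ (f x)).
Qed.

Lemma sum_triple_neq0 (F : finFieldType) (C : fieldType) (f : F -> F -> F -> C) :
  \sum_(t : F * (F * F) | t.2.2 != 0) f t.1 t.2.1 t.2.2
  = \sum_x \sum_y \sum_(w | w != 0) f x y w.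
Proof.
rewrite -(pair_big_dep xpredT (fun x (p : F * F) => p.2 != 0)
            (fun x p => f x p.1 p.2)) /=.
apply: eq_bigr => x _.
by rewrite -(pair_big_dep xpredT (fun _ w => w != 0) (f x)).
Qed.

Section TraceSums.
Variables (F : finFieldType) (C : numFieldType) (n : nat).
Variable rG : mx_representation C [set: {'GL_3[F]}] n.
Variables (E : fieldExtType F) (theta : E -> C).
Hypothesis theta_mul : multiplicative_character theta.
Hypothesis rG_theta : associated_with theta rG.
Variable psi : F -> C.
Hypothesis psi_add : additive_character psi.
Hypothesis psi_nontrivial : exists x, psi x != 1.

Local Notation rho := (mxrep rG).
Local Notation q := (#|F|%:R : C).
Local Notation d x := ((x == 0)%:R : C).

Let psiV0 : (psi 0)^-1 = 1. Proof. by rewrite psi_add.1 invr1. Qed.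
Let psiVD x y : (psi (x + y))^-1 = (psi x)^-1 * (psi y)^-1.
Proof. by rewrite psi_add.2 invfM. Qed.
Let sum_psiV := sum_additive_characterV psi_add psi_nontrivial.

(** The trace as a combination of products of delta functions of the entries,
    a form in which sums against psi factor into one-variable sums. *)
Lemma tr_unipE x y w :
  \tr (rho (unip x y w))
  = 1 - q * (d x + d w - d x * d w) + (q ^+ 3 - q ^+ 2) * (d x * d y * d w).
Proof.
rewrite (tr_unip theta_mul rG_theta) !xpair_eqE mulf_eq0.
by case: (x == 0); case: (y == 0); case: (w == 0) => /=; ring.
Qed.

Lemma sum_const (c : C) : \sum_(x : F) c = q * c.
Proof. by rewrite sumr_const mulr_natl. Qed.

(** Only the terms in which the delta functions cover both x and w survive
    summation against psi. *)
Lemma sum_tr_unip :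
  \sum_(t : F * (F * F)) (psi (t.1 + t.2.2))^-1 * \tr (rho (unip t.1 t.2.1 t.2.2))
  = q ^+ 3.
Proof.
rewrite (sum_triple (fun x y w => (psi (x + w))^-1 * \tr (rho (unip x y w)))).
pose K := q ^+ 3 - q ^+ 2.
(* The factors psi w and delta w are the only ones that involve w. *)
have sum_w x y : \sum_w (psi (x + w))^-1 * \tr (rho (unip x y w))
    = (psi x)^-1 * (- q + q * d x) + K * (d x * (psi x)^-1) * d y.
  rewrite (eq_bigr (fun w => ((psi x)^-1 * (1 - q * d x)) * (psi w)^-1
      + (psi x)^-1 * (- q + q * d x + K * (d x * d y)) * (d w * (psi w)^-1))).
    rewrite big_split /= -!mulr_sumr sum_psiV sum_delta psiV0 /K; ring.
  move=> w _; rewrite psiVD tr_unipE /K; ring.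
under eq_bigr => x _.
  under eq_bigr => y _ do rewrite sum_w mulrC [X in _ + X]mulrC.
  rewrite big_split /= sum_const (sum_delta (fun=> _)); over.
rewrite (eq_bigr (fun x => - q ^+ 2 * (psi x)^-1
   + (q ^+ 2 + K) * (d x * (psi x)^-1))); last by move=> x _; ring.
rewrite big_split /= -!mulr_sumr sum_psiV sum_delta psiV0 /K; ring.
Qed.

Lemma mira1 (a b : F) : mira a b 1 = unip a b 0.
Proof. by rewrite /mira mulr1. Qed.

Lemma sum_tr_mira :
  \sum_(t : F * (F * F) | t.2.2 != 0)
     (psi t.1)^-1 * \tr (rho (mira t.1 t.2.1 t.2.2)) = q ^+ 3 - q ^+ 2.
Proof.
rewrite (sum_triple_neq0 (fun a b g => (psi a)^-1 * \tr (rho (mira a b g)))).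
pose K := q ^+ 3 - q ^+ 2.
have sum_g a b : \sum_(g | g != 0) (psi a)^-1 * \tr (rho (mira a b g))
    = d b * (K * (d a * (psi a)^-1)) + (1 - q) * (psi a)^-1.
  rewrite (bigD1 1) ?oner_eq0 //= big1 => [|g /andP[g0 g1]]; last first.
    by rewrite (tr_mira rG_theta) ?mulr0.
  rewrite mira1 tr_unipE eqxx /K /=; ring.
under eq_bigr => a _.
  under eq_bigr => b _ do rewrite sum_g.
  rewrite big_split /= sum_const (sum_delta (fun=> _)); over.
rewrite /= big_split /= -!mulr_sumr sum_psiV sum_delta psiV0 /K; ring.
Qed.

Lemma card_mira :
  #|[pred t : F * (F * F) | t.2.2 != 0]|%:R = q ^+ 3 - q ^+ 2.
Proof.
rewrite -sum1_card natr_sum (sum_triple_neq0 (fun _ _ _ => 1)) !sum_const.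
have : \sum_(w : F) 1 = q by rewrite sum_const mulr1.
by rewrite (bigD1 0) //= => <-; ring.
Qed.

Let q_neq0 : q != 0.
Proof. by rewrite pnatr_eq0 -lt0n (ltnW (finNzRing_gt1 F)). Qed.

(** Existence and uniqueness of the Whittaker functional, together with the
    Whittaker vector that is normalized against it. *)
Lemma whittaker_rank1 :
  exists (v : 'cV[C]_n) (l : 'rV[C]_n),
    [/\ q ^+ 3 *: (v *m l) = \sum_(t : F * (F * F))
           (psi (t.1 + t.2.2))^-1 *: rho (unip t.1 t.2.1 t.2.2),
        l *m v = 1%:M,
        forall x y w, l *m rho (unip x y w) = psi (x + w) *: l,
        forall x y w, rho (unip x y w) *m v = psi (x + w) *: v &
        forall l' : 'rV[C]_n,
          (forall x y w, l' *m rho (unip x y w) = psi (x + w) *: l') ->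
          l' = (l' *m v) 0 0 *: l].
Proof.
pose m (s t : F * (F * F)) :=
  (s.1 + t.1, (s.2.1 + t.2.1 + s.1 * t.2.2, s.2.2 + t.2.2)).
have cardq : #|(xpredT : pred (F * (F * F)))|%:R = q ^+ 3 :> C.
  rewrite -natrX; congr _%:R; rewrite -[LHS]/#|{: F * (F * F)}| !card_prod.
  by rewrite expnS -mulnn.
have [|||||||||v [l [e lv lN vN uniq_l]]] := @isotypic_rank1 C n _ xpredT m
   (fun t => psi (t.1 + t.2.2)) (fun t => rho (unip t.1 t.2.1 t.2.2)).
- by move=> t _; apply: additive_character_neq0.
- by move=> s t _ _; rewrite -psi_add.2 /=; congr psi; ring.
- by move=> s t _ _; rewrite mxrepM ?unip_unit // unipM.
- move=> s _ [x [y w]] [x' [y' w']] /= [/addrI-> e /addrI w_eq].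
  by move: e; rewrite w_eq => /addIr/addrI->.
- move=> t _ [x [y w]] [x' [y' w']] /= [/addIr x_eq e /addIr->].
  by move: e; rewrite x_eq => /addIr/addIr->.
- by [].
- by [].
- by apply/card_gt0P; exists (0, (0, 0)).
- by rewrite sum_tr_unip cardq.
exists v, l; rewrite -cardq; split=> //.
- by move=> x y w; apply: (lN (x, (y, w))).
- by move=> x y w; apply: (vN (x, (y, w))).
by move=> l' l'N; apply: uniq_l => t _; apply: l'N.
Qed.

Lemma mirabolic_rank1 :
  exists (v : 'cV[C]_n) (l : 'rV[C]_n),
    forall l' : 'rV[C]_n,
      (forall a b g, g != 0 -> l' *m rho (mira a b g) = psi a *: l') ->
      l' = (l' *m v) 0 0 *: l.
Proof.
pose m (s t : F * (F * F)) :=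
  (s.1 + t.1, (s.2.1 + s.2.2 * t.2.1, s.2.2 * t.2.2)).
have [|||||||||v [l [_ _ _ _ uniq_l]]] := @isotypic_rank1 C n _
   [pred t : F * (F * F) | t.2.2 != 0] m
   (fun t => psi t.1) (fun t => rho (mira t.1 t.2.1 t.2.2)).
- by move=> t _; apply: additive_character_neq0.
- by move=> s t _ _; rewrite -psi_add.2.
- by move=> s t s0 t0; rewrite mxrepM ?mira_unit // miraM.
- move=> [a [b g]] /= g0 [x [y w]] [x' [y' w']] /= [/addrI-> e /(mulfI g0)->].
  by move: e => /addrI/(mulfI g0)->.
- move=> [a [b g]] /= g0 [x [y w]] [x' [y' w']] /= [/addIr-> e /(mulIf g0) w_eq].
  by move: e; rewrite w_eq => /addIr->.
- by move=> s t /= s0; rewrite mulf_eq0 (negPf s0).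
- by move=> s t /= t0; rewrite mulf_eq0 (negPf t0) orbF.
- by apply/card_gt0P; exists (0, (0, 1)); rewrite inE /= oner_eq0.
- by rewrite sum_tr_mira card_mira.
exists v, l => l' l'H; apply: uniq_l => t t0; exact: l'H.
Qed.
End TraceSums.

(** * Periods and the functional equation *)

Lemma mx3_1 (F : finFieldType) : 1%:M = mx3 1 0 0 0 1 0 0 0 1 :> 'M[F]_3.
Proof. by apply/matrixP => -[[|[|[|//]]] ?] [[|[|[|//]]] ?]; rewrite !mxE. Qed.

Lemma mx3_tr (F : finFieldType) (a b c d e f g h i : F) :
  (mx3 a b c d e f g h i)^T = mx3 a d g b e h c f i.
Proof. by apply/matrixP => -[[|[|[|//]]] ?] [[|[|[|//]]] ?]; rewrite !mxE. Qed.

(** The inverse transpose in the dual Whittaker function turns the lower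
    triangular [lower_z z] into an upper triangular matrix; with the swap and
    the antidiagonal matrix it becomes a monomial matrix of the 3-cycle times a
    unipotent matrix. *)
Lemma dual_translate (F : finFieldType) (g z : F) : g != 0 ->
  (GL_of_mx (antidiag3 F) * GL_of_mx
     (GLval (GL_of_mx (diag_ggo g) * GL_of_mx (lower_z z) * GL_of_mx (swap12 F))^-1)^T)%g
  = GL_of_mx (cyc g^-1 0 (- z) 0).
Proof.
move=> g0.
pose B := mx3 0 g^-1 0 g^-1 0 (- (g^-1 * z)) 0 0 1.
pose H := diag_ggo g *m lower_z z *m swap12 F.
have uH : H \in unitmx.
  by rewrite !unitmx_mul diag_ggo_unitmx // lower_z_unitmx swap12_unitmx.
have BH : B^T *m H = 1%:M.
  rewrite mx3_1 mx3_tr /H /diag_ggo /lower_z /swap12 -!/(mx3 _ _ _ _ _ _ _ _ _).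
  by rewrite !mx3M; congr mx3; field.
have -> : (GL_of_mx (diag_ggo g) * GL_of_mx (lower_z z) * GL_of_mx (swap12 F))%g
          = GL_of_mx H.
  by rewrite !GL_of_mxM ?unitmx_mul ?diag_ggo_unitmx ?lower_z_unitmx ?swap12_unitmx.
rewrite GL_VxE GLval_of_mx //.
have -> : (invmx H)^T = B.
  by rewrite -[invmx H]mul1mx -BH mulmxK // trmxK.
rewrite -GL_of_mxM ?antidiag3_unitmx //; last first.
  by rewrite -unitmx_tr; case/mulmx1_unit: BH.
congr GL_of_mx; rewrite /antidiag3 -!/(mx3 _ _ _ _ _ _ _ _ _).
by mx3_eq.
Qed.

Section WhittakerFunctionals.
Variables (F : finFieldType) (C : fieldType) (n : nat).
Variable rG : mx_representation C [set: {'GL_3[F]}] n.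
Variable psi : F -> C.
Local Notation rho := (mxrep rG).

Definition unip_equivariant (l : 'rV[C]_n) :=
  forall x y w, l *m rho (unip x y w) = psi (x + w) *: l.

Lemma whittaker_functionalP l :
  whittaker_functional rG psi l <-> unip_equivariant l.
Proof.
split=> lN.
  move=> x y w; have uU := unip_unit x y w.
  rewrite /mxrep lN; first by rewrite GLval_of_mx // !mxE !inordK.
  move=> i j; rewrite GLval_of_mx // !mxE.
  by case: i j => [[|[|[|//]]] ?] [[|[|[|//]]] ?].
move=> u u_unip.
pose U i j := GLval u (inord i) (inord j).
have uE : GLval u = unip (U 0 1) (U 0 2) (U 1 2).
  apply/matrixP => r s; rewrite -[r]inord_val -[s]inord_val -/(U r s) !mxE !inordK //.
  case: r s => [[|[|[|//]]] ?] [[|[|[|//]]] ?] //=;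
  by rewrite /U u_unip ?inordK // -val_eqE /= !inordK.
by have := lN (U 0 1) (U 0 2) (U 1 2); rewrite /mxrep -uE GL_of_mxK.
Qed.

Definition diag_period (l : 'rV[C]_n) := \sum_(g | g != 0) l *m rho (diag_ggo g).
Definition cyc_period (l : 'rV[C]_n) :=
  \sum_(g | g != 0) \sum_z l *m rho (cyc g 0 z 0).

Lemma diag_periodZ c l : diag_period (c *: l) = c *: diag_period l.
Proof. by rewrite scaler_sumr; apply: eq_bigr => g _; rewrite scalemxAl. Qed.

Lemma cyc_periodZ c l : cyc_period (c *: l) = c *: cyc_period l.
Proof.
rewrite scaler_sumr; apply: eq_bigr => g _; rewrite scaler_sumr.
by apply: eq_bigr => z _; rewrite scalemxAl.
Qed.

Section Equivariance.
Variable l : 'rV[C]_n.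
Hypothesis lN : unip_equivariant l.

Lemma diag_period_mira a b h : h != 0 ->
  diag_period l *m rho (mira a b h) = psi a *: diag_period l.
Proof.
move=> h0; rewrite mulmx_suml scaler_sumr [RHS](reindex_inj (mulIf h0)) /=.
apply: eq_big => [g|g g0]; first by rewrite mulf_eq0 negb_or h0 andbT.
rewrite -mulmxA mxrepM ?diag_ggo_unitmx ?mira_unit // diag_mira.
by rewrite -mxrepM ?unip_unit ?diag_ggo_unitmx ?mulf_neq0 // mulmxA lN addr0 scalemxAl.
Qed.

Lemma cyc_period_mira a b h : h != 0 ->
  cyc_period l *m rho (mira a b h) = psi a *: cyc_period l.
Proof.
move=> h0; rewrite mulmx_suml scaler_sumr [RHS](reindex_inj (mulIf h0)) /=.
apply: eq_big => [g|g g0]; first by rewrite mulf_eq0 negb_or h0 andbT.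
have shift_inj : injective (fun z => (b + z) / h).
  by move=> z z' /(mulIf _)/addrI; apply; rewrite invr_eq0.
rewrite mulmx_suml scaler_sumr [RHS](reindex_inj shift_inj) /=.
apply: eq_bigr => z _.
rewrite -mulmxA mxrepM ?cyc_unit ?mira_unit // cyc_mira //.
by rewrite -mxrepM ?unip_unit ?cyc_unit ?mulf_neq0 // mulmxA lN add0r scalemxAl.
Qed.

Lemma cyc_lower_equiv g z a : g != 0 ->
  l *m rho (cyc g 0 z 0) *m rho (lower_z a) = psi (z * a) *: (l *m rho (cyc g 0 z 0)).
Proof.
move=> g0; rewrite -mulmxA mxrepM ?cyc_unit ?lower_z_unitmx // cyc_lower //.
by rewrite -mxrepM ?unip_unit ?cyc_unit // mulmxA lN add0r scalemxAl.
Qed.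
End Equivariance.

Lemma JS_sumE (W : {'GL_3[F]} -> C) (l : 'rV[C]_n) (v : 'cV[C]_n) phi :
  (forall g, W g = (l *m rG g *m v) 0 0) ->
  JS_sum W phi = (#|[pred x : F | x != 0]| * #|F|)%:R^-1 *
     \sum_x phi x * (diag_period l *m rho (lower_z x) *m v) 0 0.
Proof.
move=> WE; rewrite /JS_sum exchange_big /=; congr (_ * _); apply: eq_bigr => x _.
rewrite -mulr_suml mulrC !mulmx_suml summxE; congr (_ * _).
apply: eq_bigr => g g0; rewrite WE -mulmxA -/(mxrep _ _).
by rewrite repr_mxM ?inE // !mulmxA.
Qed.
End WhittakerFunctionals.

(** The factor psi (x z)^-1 of the Fourier transform is absorbed by moving
    [lower_z x] through the matrices [cyc g 0 z 0], which turns the dual sum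
    into translates of a single functional. *)
Lemma JS_dual_sumE (F : finFieldType) (C : numClosedFieldType) n
    (rG : mx_representation C [set: {'GL_3[F]}] n) (psi : F -> C)
    (psi_add : additive_character psi)
    (W : {'GL_3[F]} -> C) (l : 'rV[C]_n) (v : 'cV[C]_n) (phi : F -> C) :
  (forall g, W g = (l *m rG g *m v) 0 0) -> unip_equivariant rG psi l ->
  JS_dual_sum (fun x => (psi x)^-1) W phi =
    (#|[pred x : F | x != 0]| * #|F|)%:R^-1 * ((sqrtC #|F|%:R)^-1 *
     \sum_x phi x * (cyc_period rG l *m mxrep rG (lower_z x) *m v) 0 0).
Proof.
move=> WE lN; rewrite /JS_dual_sum /JS_sum; congr (_ * _).
pose T g z := (l *m mxrep rG (cyc g 0 z 0) *m v) 0 0.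
have periodE x : (cyc_period rG l *m mxrep rG (lower_z x) *m v) 0 0
    = \sum_(g | g != 0) \sum_z psi (- z * x) * T g^-1 (- z).
  rewrite /cyc_period !mulmx_suml summxE (reindex_inj invr_inj) /=.
  apply: eq_big => [g|g]; first by rewrite invr_eq0.
  rewrite invr_eq0 => g0; rewrite !mulmx_suml summxE (reindex_inj oppr_inj).
  apply: eq_bigr => z _; rewrite (cyc_lower_equiv lN) ?invr_eq0 //.
  by rewrite -scalemxAl mxE.
under [in RHS]eq_bigr => x _ do rewrite periodE mulr_sumr.
rewrite [in RHS]exchange_big mulr_sumr; apply: eq_bigr => g g0.
under [in RHS]eq_bigr => x _ do rewrite mulr_sumr.
rewrite [in RHS]exchange_big mulr_sumr; apply: eq_bigr => z _.
rewrite /whittaker_dual dual_translate // WE -/(mxrep _ _) -/(T _ _).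
rewrite /fourier mulrCA; congr (_ * _); rewrite mulr_sumr.
apply: eq_bigr => x _.
by rewrite mulNr (additive_characterN psi_add) [z * x]mulrC; ring.
Qed.

(** * The Bessel function and the constant *)

Lemma additive_character_separates (F C : fieldType) (psi : F -> C) :
  additive_character psi -> (exists x, psi x != 1) ->
  forall c c', c != c' -> exists b, psi (c * b) != psi (c' * b).
Proof.
move=> psi_add [a psi_a] c c'; rewrite -subr_eq0 => cc'; exists (a / (c - c')).
have -> : c * (a / (c - c')) = a + c' * (a / (c - c')) by field.
rewrite psi_add.2 -subr_eq0 -[X in _ - X]mul1r -mulrBl mulf_neq0 ?subr_eq0 //.
exact: additive_character_neq0.
Qed.

Section Bessel.
Variables (F : finFieldType) (C : fieldType) (n : nat).
Variable rG : mx_representation C [set: {'GL_3[F]}] n.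
Variable psi : F -> C.
Hypothesis psi_add : additive_character psi.
Hypothesis psi_nontrivial : exists x, psi x != 1.
Variables (l : 'rV[C]_n) (v : 'cV[C]_n).
Hypothesis lN : unip_equivariant rG psi l.
Hypothesis vN : forall x y w, mxrep rG (unip x y w) *m v = psi (x + w) *: v.
Hypothesis lv : l *m v = 1%:M.

Definition bessel (M : 'M[F]_3) : C := (l *m mxrep rG M *m v) 0 0.

Lemma besselMr M x y w : M \in unitmx ->
  bessel (M *m unip x y w) = psi (x + w) * bessel M.
Proof.
move=> uM; rewrite /bessel -mxrepM ?unip_unit // -!mulmxA vN.
by rewrite -!scalemxAr mxE.
Qed.

Lemma besselMl M x y w : M \in unitmx ->
  bessel (unip x y w *m M) = psi (x + w) * bessel M.
Proof.
move=> uM; rewrite /bessel -mxrepM ?unip_unit // mulmxA lN.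
by rewrite -!scalemxAl mxE.
Qed.

Lemma bessel1 : bessel 1%:M = 1.
Proof.
rewrite /bessel /mxrep; have -> : GL_of_mx 1%:M = 1%g :> {'GL_3[F]}.
  by apply: val_inj; apply: GLval_of_mx; apply: unitmx1.
by rewrite repr_mx1 mulmx1 lv mxE.
Qed.

(** Computing the value at M u = u' M through the left and through the right
    gives two multiples of the value at M. *)
Lemma bessel_vanish M x y w x' y' w' : M \in unitmx ->
  M *m unip x y w = unip x' y' w' *m M -> psi (x + w) != psi (x' + w') ->
  bessel M = 0.
Proof.
move=> uM e psi_neq; have := besselMr x y w uM; rewrite e besselMl // => /eqP.
rewrite -subr_eq0 -mulrBl mulf_eq0 subr_eq0 eq_sym (negPf psi_neq).
by move/eqP.
Qed.

Let separate := additive_character_separates psi_add psi_nontrivial.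

Lemma bessel_diag g : g != 0 -> bessel (diag_ggo g) = (g == 1)%:R.
Proof.
move=> g0; have [->|g1] := eqVneq g 1.
  by rewrite -[RHS]bessel1; congr bessel; rewrite mx3_1.
have [w psi_w] := separate g1.
apply: (@bessel_vanish _ 0 0 w 0 0 (g * w)); first exact: diag_ggo_unitmx.
  by rewrite /diag_ggo -/(mx3 _ _ _ _ _ _ _ _ _); mx3_eq.
by rewrite mul1r in psi_w; rewrite !add0r eq_sym.
Qed.

Lemma diag_period_bessel : (diag_period rG l *m v) 0 0 = 1.
Proof.
rewrite mulmx_suml summxE (bigD1 1) ?oner_eq0 //= [X in X + _]bessel_diag ?oner_eq0 //.
rewrite eqxx big1 ?addr0 // => g /andP[g0 /negPf g1].
by rewrite [LHS]bessel_diag // g1.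
Qed.

(** The inverse of [cyc 1 0 0 0]. *)
Definition cycle3 : 'M[F]_3 := mx3 0 1 0 0 0 1 1 0 0.

Lemma cycle3_unit : cycle3 \in unitmx.
Proof.
rewrite unitmxE; suff -> : \det cycle3 = 1 by exact: unitr1.
by rewrite det_mx3E; ring.
Qed.

(** The product is lower triangular, with second row (g z, g, 0).  If z != 0
    it moves the entry (1,3) of a unipotent matrix to (2,3), where psi sees it;
    if z = 0 and g != 1 it rescales the entry (1,2). *)
Lemma bessel_cyc_cycle3 g z : g != 0 ->
  bessel (cyc g 0 z 0 *m cycle3) = ((z == 0) && (g == 1))%:R.
Proof.
move=> g0; have uM : cyc g 0 z 0 *m cycle3 \in unitmx.
  by rewrite unitmx_mul cyc_unit // cycle3_unit.
have ME : cyc g 0 z 0 *m cycle3 = mx3 1 0 0 (g * z) g 0 0 0 g by mx3_eq.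
have [z0|z0] := eqVneq z 0; last first.
  have [b psi_b] := separate z0.
  apply: (@bessel_vanish _ 0 b 0 0 (b / g) (z * b)) => //.
    by rewrite ME !mx3M; congr mx3; field.
  by rewrite mul0r in psi_b; rewrite !add0r eq_sym.
have [g1|g1] := eqVneq g 1.
  by rewrite -[RHS]bessel1; congr bessel; rewrite mx3_1 z0 g1; mx3_eq.
have gV1 : g^-1 != 1 by rewrite invr_eq1.
have [a psi_a] := separate gV1.
apply: (@bessel_vanish _ a 0 0 (a / g) 0 0) => //.
  by rewrite ME z0 !mx3M; congr mx3; field.
by rewrite mul1r mulrC in psi_a; rewrite !addr0 eq_sym.
Qed.

(** After translation by [cycle3], only the term g = 1, z = 0 of the period is
    nonzero at the Whittaker vector, and it is the value of the Bessel function
    at 1. *)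
Lemma cyc_period_neq0 : cyc_period rG l != 0.
Proof.
suff e : (cyc_period rG l *m mxrep rG cycle3 *m v) 0 0 = 1.
  by apply: contra_eq_neq e => ->; rewrite !mul0mx mxE eq_sym oner_eq0.
have T g z : g != 0 ->
    (l *m mxrep rG (cyc g 0 z 0) *m mxrep rG cycle3 *m v) 0 0
    = ((z == 0) && (g == 1))%:R.
  move=> g0; rewrite -[l *m _ *m _]mulmxA mxrepM ?cyc_unit ?cycle3_unit //.
  by rewrite [LHS]bessel_cyc_cycle3.
rewrite /cyc_period !mulmx_suml summxE (bigD1 1) ?oner_eq0 //= [X in _ + X]big1; last first.
  move=> g /andP[g0 /negPf g1]; rewrite !mulmx_suml summxE big1 // => z _.
  by rewrite T // g1 andbF.
rewrite addr0 !mulmx_suml summxE (bigD1 0) //= T ?oner_eq0 // !eqxx.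
by rewrite big1 ?addr0 // => z /negPf z0; rewrite T ?oner_eq0 // z0.
Qed.

Lemma cyc_period_bessel :
  (cyc_period rG l *m v) 0 0 = #|F|%:R * \sum_(g | g != 0) bessel (cyc g 0 0 0).
Proof.
rewrite mulmx_suml summxE mulr_sumr; apply: eq_bigr => g g0.
rewrite mulmx_suml summxE mulr_natl -sumr_const; apply: eq_bigr => z _.
rewrite -[LHS]/(bessel _) -[cyc g 0 z 0]cyc_unip besselMr ?cyc_unit //.
by rewrite addr0 psi_add.1 mul1r.
Qed.

End Bessel.

Section Gamma.
Variables (F : finFieldType) (C : numClosedFieldType) (n : nat).
Variable rG : mx_representation C [set: {'GL_3[F]}] n.
Variables (E : fieldExtType F) (degE : \dim {:E} = 3%N) (theta : E -> C).
Hypothesis theta_mul : multiplicative_character theta.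
Hypothesis rG_theta : associated_with theta rG.
Variable psi : F -> C.
Hypothesis psi_add : additive_character psi.
Hypothesis psi_nontrivial : exists x, psi x != 1.
Local Notation q := (#|F|%:R : C).

Let q_neq0 : q != 0.
Proof. by rewrite pnatr_eq0 -lt0n (ltnW (finNzRing_gt1 F)). Qed.

Definition gamma_sum : C :=
  \sum_(xi : finvect_type E | xi != 0)
     psi (- (field_trace ((xi : E) ^+ 2) / field_norm (xi : E)))
     * theta ((xi : E) ^+ 2).

Definition gamma_value : C := sqrtC q ^- 3 * gamma_sum.

(** The two periods of the Whittaker functional are proportional by
    multiplicity one on H; the ratio is read off at the Whittaker vector, where
    the first period is 1 and the second a character sum. *)
Lemma whittaker_periods :
  exists (v : 'cV[C]_n) (l : 'rV[C]_n),
    [/\ whittaker_functional rG psi l,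
        forall l', whittaker_functional rG psi l' -> exists c, l' = c *: l,
        (diag_period rG l *m v) 0 0 = 1,
        cyc_period rG l = (sqrtC q * gamma_value) *: diag_period rG l &
        gamma_value != 0].
Proof.
have [v [l [e lv lN vN uniq_l]]] :=
  whittaker_rank1 theta_mul rG_theta psi_add psi_nontrivial.
have [v1 [l1 uniq_l1]] :=
  mirabolic_rank1 theta_mul rG_theta psi_add psi_nontrivial.
have dv := diag_period_bessel psi_add psi_nontrivial lN vN lv.
have d_l1 := uniq_l1 _ (fun a b g => diag_period_mira lN a b (h := g)).
have c_l1 := uniq_l1 _ (fun a b g => cyc_period_mira lN a b (h := g)).
have sq0 : sqrtC q != 0 by rewrite sqrtC_eq0.
have besselE M : M \in unitmx ->
    q ^+ 3 * bessel rG l v M = \sum_(t : F * (F * F))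
      (psi (t.1 + t.2.2))^-1 * \tr (mxrep rG (M *m unip t.1 t.2.1 t.2.2)).
  move=> uM; have -> : bessel rG l v M = \tr (mxrep rG M *m (v *m l)).
    by rewrite mulmxA mxtrace_mulC mulmxA /mxtrace big_ord1.
  rewrite -mxtraceZ scalemxAr e mulmx_sumr raddf_sum; apply: eq_bigr => t _ /=.
  by rewrite -scalemxAr mxtraceZ mxrepM ?unip_unit.
have cv : (cyc_period rG l *m v) 0 0 = q^-1 * gamma_sum.
  rewrite (cyc_period_bessel psi_add) //.
  apply: (mulfI (expf_neq0 2 q_neq0)).
  transitivity (q * gamma_sum); last by field.
  rewrite -(sum_cyc_char degE theta psi_add) mulrA -exprSr mulr_sumr.
  apply: eq_bigr => g g0; rewrite besselE ?cyc_unit //.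
  apply: eq_bigr => t _; rewrite cyc_unip.
  by rewrite (tr_cyc degE rG_theta).
have prop : cyc_period rG l = (sqrtC q * gamma_value) *: diag_period rG l.
  set a := (diag_period rG l *m v1) 0 0 in d_l1.
  have a0 : a != 0.
    apply: contra_eq_neq dv => a0; rewrite d_l1 a0 scale0r mul0mx mxE.
    by rewrite eq_sym oner_eq0.
  set c := (_ *m v1) 0 0 in c_l1.
  have cE : cyc_period rG l = (c / a) *: diag_period rG l.
    by rewrite c_l1 d_l1 scalerA divfK.
  rewrite cE; congr (_ *: _).
  have := cv; rewrite cE -scalemxAl mxE dv mulr1 => ->.
  rewrite /gamma_value -[in q^-1](sqrtCK q); field; exact: sq0.
exists v, l; split=> //.
- exact/whittaker_functionalP.
- by move=> l' /whittaker_functionalP/uniq_l; exists ((l' *m v) 0 0).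
have := cyc_period_neq0 psi_add psi_nontrivial lN vN lv.
by apply: contra_neq => g0; rewrite prop g0 mulr0 scale0r.
Qed.

Lemma gamma_functional_equation :
  is_exterior_square_gamma rG psi (fun x => (psi x)^-1) gamma_value.
Proof.
have [v0 [l0 [l0N uniq_l _ prop g0]]] := whittaker_periods.
split=> // W phi [l [_ lN] [v WE]].
rewrite (JS_sumE _ WE) (JS_dual_sumE psi_add _ WE); last exact/whittaker_functionalP.
have -> : cyc_period rG l = (sqrtC q * gamma_value) *: diag_period rG l.
  have [c ->] := uniq_l _ lN.
  by rewrite cyc_periodZ diag_periodZ prop !scalerA mulrC.
rewrite [RHS]mulrCA; congr (_ * _).
rewrite [in LHS](eq_bigr (fun x => (sqrtC q * gamma_value) *
   (phi x * (diag_period rG l *m mxrep rG (lower_z x) *m v) 0 0))); last first.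
  by move=> x _; rewrite -!scalemxAl mxE mulrCA.
by rewrite -mulr_sumr !mulrA mulVf ?mul1r // sqrtC_eq0.
Qed.

(** The delta function at 0 has the same Fourier transform with respect to
    every psiF, and J does not vanish at it for the Whittaker vector. *)
Lemma gamma_unique (psiF : F -> C) c : psiF 0 = 1 ->
  is_exterior_square_gamma rG psi psiF c -> c = gamma_value.
Proof.
move=> psiF0 [_ cE].
have [v [l [lN _ dv _ _]]] := whittaker_periods.
pose W g := (l *m rG g *m v) 0 0.
pose phi (x : F) : C := (x == 0)%:R.
have l0 : l != 0.
  apply: contra_eq_neq dv => ->; rewrite /diag_period big1.
    by rewrite mul0mx mxE eq_sym oner_eq0.
  by move=> g _; rewrite mul0mx.
have W_model : whittaker_model rG psi W by exists l => //; exists v.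
have fourier_phi psi' y : psi' 0 = 1 -> fourier psi' phi y = (sqrtC q)^-1.
  move=> e; rewrite /fourier (sum_delta (fun x => psi' (x * y))) mul0r e.
  by rewrite mulr1.
have dualE psi' : psi' 0 = 1 -> JS_dual_sum psi' W phi =
    JS_sum (fun g => whittaker_dual W (g * GL_of_mx (swap12 F))%g) (fun=> (sqrtC q)^-1).
  move=> e; rewrite /JS_dual_sum /JS_sum; congr (_ * _).
  by apply: eq_bigr => g _; apply: eq_bigr => z _; rewrite fourier_phi.
have psiV0 : (psi 0)^-1 = 1 by rewrite psi_add.1 invr1.
have := cE W phi W_model; rewrite dualE // -(dualE (fun x => (psi x)^-1)) //.
rewrite gamma_functional_equation.2 // => /esym; apply: mulIf.
rewrite (@JS_sumE _ _ _ rG W l v) // mulf_neq0 //.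
  rewrite invr_eq0 pnatr_eq0 muln_eq0 negb_or; apply/andP; split.
    by rewrite -lt0n; apply/card_gt0P; exists 1; rewrite inE oner_eq0.
  by rewrite -lt0n (ltnW (finNzRing_gt1 F)).
rewrite sum_delta.
have -> : lower_z 0 = 1%:M :> 'M[F]_3 by rewrite mx3_1.
have -> : mxrep rG 1%:M = 1%:M.
  rewrite /mxrep; have -> : GL_of_mx 1%:M = 1%g :> {'GL_3[F]}.
    by apply: val_inj; apply: GLval_of_mx; apply: unitmx1.
  by rewrite repr_mx1.
by rewrite mulmx1 dv oner_eq0.
Qed.
End Gamma.

Theorem theorem2p38 (R : realType) (F : finFieldType) (E : fieldExtType F)
    (degE : \dim {:E} = 3%N)
    (psi : F -> R[i]) (psi_add : additive_character psi)
    (psi_nontrivial : exists x : F, psi x != 1)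
    (theta : E -> R[i]) (theta_mul : multiplicative_character theta)
    (theta_reg : regular_character theta)
    (n : nat) (pi : mx_representation R[i] [set: {'GL_3[F]}] n)
    (pi_irr : mx_irreducible pi) (pi_cusp : cuspidal pi)
    (pi_theta : associated_with theta pi) :
  (* [finvect_type E] is E with its structure of finite type *)
  let gamma : R[i] :=
    sqrtC #|F|%:R ^- 3 *
    \sum_(xi : finvect_type E | xi != 0)
       psi (- (field_trace ((xi : E) ^+ 2) / field_norm (xi : E)))
       * theta ((xi : E) ^+ 2) in
  (forall c : R[i],
     is_exterior_square_gamma pi psi (fun x => (psi x)^-1) c <-> c = gamma)
  /\
  (forall c : R[i],
     is_exterior_square_gamma pi psi psi c -> c = gamma).
Proof.
split=> c.
  split=> [|->].
    apply: (gamma_unique degE theta_mul pi_theta psi_add psi_nontrivial).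
    by rewrite psi_add.1 invr1.
  exact: (gamma_functional_equation degE theta_mul pi_theta psi_add psi_nontrivial).
apply: (gamma_unique degE theta_mul pi_theta psi_add psi_nontrivial).
exact: psi_add.1.
Qed.
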